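(* Let $G$ be a finite set and let $s,t\colon z\to w$ be a pair of parallel morphisms in $\mathbb{P}G$, the free permutative category on a set of invertible generators $G$. Then $s$ and $t$ are equal as morphisms in $\mathbb{P}G$ if and only if they have the same $a$-parity, $\mathsf{p}_a(s)=\mathsf{p}_a(t)$, for each $a\in G$.
   Context: A permutative category $(A,+,0,\beta)$ is a strict monoidal category $(A,+,0)$ with a natural isomorphism $\beta_{x,y}\colon x+y\to y+x$ such that $\beta_{y,x}\beta_{x,y}=\mathrm{id}$ and $\beta_{x,y+z}=(\mathrm{id}_y+\beta_{x,z})\circ(\beta_{x,y}+\mathrm{id}_z)$. A strict symmetric monoidal functor is a functor strictly preserving $+$, $0$ and $\beta$. $\mathsf{PermCat}_s$ denotes the 2-category of (small) permutative categories, strict symmetric monoidal functors and monoidal transformations; it has all (2-categorical) colimits. $\mathbb{S}C$ denotes the free permutative category on a small category $C$. An invertible pair in $A$ is a tuple $(a,a',\eta,\varepsilon)$ with objects $a,a'$ and isomorphisms $\eta\colon 0\to a'+a$, $\varepsilon\colon a+a'\to 0$ such that $(\varepsilon+\mathrm{id}_a)\circ(\mathrm{id}_a+\eta)=\mathrm{id}_a$ and $(\mathrm{id}_{a'}+\varepsilon)\circ(\eta+\mathrm{id}_{a'})=\mathrm{id}_{a'}$. The free permutative category $\mathcal{P}=\mathcal{P}\{x\}$ on an invertible generator $x$ is built by successive pushouts in $\mathsf{PermCat}_s$. Write $\{a,b\}$, $\{a\cong b\}$, $\{a\to b\}$, $\{a\rightrightarrows b\}$ for the categories with two objects $a,b$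 and, respectively, no non-identity morphisms, one isomorphism between $a$ and $b$, one non-identity morphism $a \to b$, two distinct non-identity morphisms $a\to b$; let $p\colon\{a,b\}\to\{a\cong b\}$ and $q\colon\{a\rightrightarrows b\}\to\{a\to b\}$ be the identity-on-objects functors. (1) $\mathcal{S}_1$ is the pushout of $\mathbb{S}p$ along $\mathbb{S}\{a,b\}\to\mathbb{S}\{x,y\}$, $a\mapsto x+y$, $b\mapsto 0$; the image of $a\cong b$ is called $\varepsilon\colon x+y\cong 0$. (2) $\mathcal{S}_2$ is the pushout of $\mathbb{S}p$ along $\mathbb{S}\{a,b\}\to\mathcal{S}_1$, $a\mapsto 0$, $b\mapsto y+x$; the image of $a\cong b$ is called $\eta\colon 0\cong y+x$. (3) $\mathcal{S}_3$ is the pushout of $\mathbb{S}q$ along $\mathbb{S}\{a\rightrightarrows b\}\to\mathcal{S}_2$ sending the two arrows to $(\varepsilon+x)\circ(x+\eta)$ and $\mathrm{id}_x$. (4) $\mathcal{P}$ is the pushout of $\mathbb{S}q$ along $\mathbb{S}\{a\rightrightarrows b\}\to\mathcal{S}_3$ sending the two arrows to $(y+\varepsilon)\circ(\eta+y)$ and $\mathrm{id}_y$. Thus $(x,y,\eta,\varepsilon)$ is an invertible pair in $\mathcal{P}$, and strict symmetric monoidal functors $\mathcal{P}\to A$ correspond bijectively to invertible pairs in $A$ (the images of $(x,y,\eta,\varepsilon)$). For a finite set $G$, $\mathbb{P}G=\coprod_{g\in G}\mathcal{P}\{g\}$, the coproduct in $\mathsf{PermCat}_s$ of copies of $\mathcal{P}$.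 The super integers $\mathcal{Z}$: the permutative category with objects the integers, $\mathcal{Z}(k,j)=\emptyset$ if $k\ne j$, $\mathcal{Z}(k,k)=\{1_k,-1_k\}$ with composition given by multiplication in $\{\pm1\}$; monoidal sum given by addition of integers on objects and $\mu_k+\nu_j=(\mu\nu)_{k+j}$ on morphisms; unit $0$; symmetry $\beta_{k,j}=((-1)^{jk})_{k+j}$. $K\colon\mathcal{P}\to\mathcal{Z}$ is the unique strict symmetric monoidal functor with $K(x)=1$, $K(y)=-1$, $K(\eta)=\mathrm{id}_0$, $K(\varepsilon)=\mathrm{id}_0$. Let $C_2=\{0,1\}$ be the additive group of order two and put $L(1_k)=0$, $L(-1_k)=1$. The parity of a morphism $f$ of $\mathcal{P}$ is $\mathsf{p}(f)=L(K(f))\in C_2$. For $a\in G$, $I_a\colon\mathbb{P}G\to\mathcal{P}\{a\}$ is the strict symmetric monoidal functor whose restriction along the coproduct inclusion $\mathcal{P}\{g\}\to\mathbb{P}G$ is the identity if $g=a$ and is constant at the monoidal unit $0$ (and $\mathrm{id}_0$) if $g\ne a$. (Equivalently, $I_a$ is the composite of the canonical comparison functor $\coprod_{g}\mathcal{P}\{g\}\to\prod_g\mathcal{P}\{g\}$ with the projection to the factor $a$.) The $a$-parity of a morphism $f$ in $\mathbb{P}G$ is $\mathsf{p}_a(f)=\mathsf{p}(I_af)\in C_2$. *)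

(* Defs.v *)
From mathcomp Require Import all_boot all_order all_algebra.

Set Implicit Arguments.
Unset Strict Implicit.
Unset Printing Implicit Defensive.

Import GRing.Theory.

(* Small categories are given by a type of objects and a type of all           *)
(* morphisms, with source and target maps.  Strict monoidal structures are     *)
(* then governed by plain equalities of objects and morphisms, without         *)
(* transports between hom types.  [comp g f] is the composite of f followed    *)
(* by g; it is a total function, but its value is constrained, and functors    *)
(* have to preserve it, only when [src g = tgt f].                             *)
Record cat := Cat {
  ob : Type;
  mor : Type;
  src : mor -> ob;
  tgt : mor -> ob;
  idm : ob -> mor;
  comp : mor -> mor -> mor;
  src_idm : forall x, src (idm x) = x;
  tgt_idm : forall x, tgt (idm x) = x;
  src_comp : forall g f, src g = tgt f -> src (comp g f) = src f;
  tgt_comp : forall g f, src g = tgt f -> tgt (comp g f) = tgt g;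
  comp_idl : forall f, comp (idm (tgt f)) f = f;
  comp_idr : forall f, comp f (idm (src f)) = f;
  compA : forall h g f, src h = tgt g -> src g = tgt f ->
    comp h (comp g f) = comp (comp h g) f
}.

Arguments src {c}.
Arguments tgt {c}.
Arguments idm {c}.
Arguments comp {c}.

Declare Scope perm_scope.
Delimit Scope perm_scope with perm.
Local Open Scope perm_scope.

Notation "g ∘ f" := (comp g f) (at level 40, left associativity) : perm_scope.

Definition is_hom (C : cat) (f : mor C) (x y : ob C) : Prop :=
  src f = x /\ tgt f = y.

Definition parallel (C : cat) (f g : mor C) : Prop :=
  src f = src g /\ tgt f = tgt g.

Record functor (C D : cat) := Functor {
  fob : ob C -> ob D;
  fmor : mor C -> mor D;
  fsrc : forall f, src (fmor f) = fob (src f);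
  ftgt : forall f, tgt (fmor f) = fob (tgt f);
  fidm : forall x, fmor (idm x) = idm (fob x);
  fcomp : forall g f, src g = tgt f -> fmor (g ∘ f) = fmor g ∘ fmor f
}.

Definition eqF (C D : cat) (F F' : functor C D) : Prop :=
  (forall x, fob F x = fob F' x) /\ (forall f, fmor F f = fmor F' f).

Lemma eqF_refl (C D : cat) (F : functor C D) : eqF F F.
Proof. by []. Qed.

Lemma eqF_sym (C D : cat) (F F' : functor C D) : eqF F F' -> eqF F' F.
Proof. by case=> ho hm; split=> ?; rewrite ?ho ?hm. Qed.

Lemma eqF_trans (C D : cat) (F F' F'' : functor C D) :
  eqF F F' -> eqF F' F'' -> eqF F F''.
Proof. by move=> [ho hm] [ho' hm']; split=> ?; rewrite ?ho ?hm ?ho' ?hm'. Qed.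

Definition compF (C D E : cat) (G : functor D E) (F : functor C D) :
  functor C E.
Proof.
refine (@Functor C E (fun x => fob G (fob F x)) (fun f => fmor G (fmor F f))
  _ _ _ _).
- by move=> f; rewrite !fsrc.
- by move=> f; rewrite !ftgt.
- by move=> x; rewrite !fidm.
- by move=> g f h; rewrite !fcomp // fsrc ftgt h.
Defined.

Record permCat := PermCat {
  ucat :> cat;
  addo : ob ucat -> ob ucat -> ob ucat;
  zero : ob ucat;
  addm : mor ucat -> mor ucat -> mor ucat;
  braid : ob ucat -> ob ucat -> mor ucat;
  src_addm : forall f g, src (addm f g) = addo (src f) (src g);
  tgt_addm : forall f g, tgt (addm f g) = addo (tgt f) (tgt g);
  addm_idm : forall x y, addm (idm x) (idm y) = idm (addo x y);
  addm_comp : forall g f g' f', src g = tgt f -> src g' = tgt f' ->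
    addm (g ∘ f) (g' ∘ f') = addm g g' ∘ addm f f';
  addoA : forall x y z, addo x (addo y z) = addo (addo x y) z;
  add0o : forall x, addo zero x = x;
  addo0 : forall x, addo x zero = x;
  addmA : forall f g h, addm f (addm g h) = addm (addm f g) h;
  add0m : forall f, addm (idm zero) f = f;
  addm0 : forall f, addm f (idm zero) = f;
  src_braid : forall x y, src (braid x y) = addo x y;
  tgt_braid : forall x y, tgt (braid x y) = addo y x;
  braid_nat : forall f g,
    braid (tgt f) (tgt g) ∘ addm f g = addm g f ∘ braid (src f) (src g);
  braidK : forall x y, braid y x ∘ braid x y = idm (addo x y);
  braid_addo : forall x y z,
    braid x (addo y z) = addm (idm y) (braid x z) ∘ addm (braid x y) (idm z)
}.

Arguments addo {p}.
Arguments zero {p}.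
Arguments addm {p}.
Arguments braid {p}.

Notation "x ⊕ y" := (addo x y) (at level 50, left associativity) : perm_scope.
Notation "f ⊞ g" := (addm f g) (at level 50, left associativity) : perm_scope.

Record ssmFunctor (A B : permCat) := SsmFunctor {
  ufun :> functor A B;
  fadd : forall x y, fob ufun (x ⊕ y) = fob ufun x ⊕ fob ufun y;
  fzero : fob ufun zero = zero;
  faddm : forall f g, fmor ufun (f ⊞ g) = fmor ufun f ⊞ fmor ufun g;
  fbraid : forall x y, fmor ufun (braid x y) = braid (fob ufun x) (fob ufun y)
}.

Definition idS (A : permCat) : ssmFunctor A A.
Proof.
by unshelve refine (@SsmFunctor A A (@Functor A A id id _ _ _ _) _ _ _ _).
Defined.

Definition constS (A B : permCat) : ssmFunctor A B.
Proof.
unshelve refine (@SsmFunctor A B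
  (@Functor A B (fun=> zero) (fun=> idm zero) _ _ _ _) _ _ _ _) => //=.
- by move=> _; rewrite src_idm.
- by move=> _; rewrite tgt_idm.
- by move=> _ _ _; rewrite -[X in comp _ (idm X)](src_idm (zero : ob B)) comp_idr.
- by move=> _ _; rewrite add0o.
- by move=> _ _; rewrite add0m.
- move=> _ _.
  have b0 : braid zero zero ∘ braid zero zero = braid zero (zero : ob B).
    by have := braid_addo (zero : ob B) zero zero; rewrite add0o add0m addm0.
  by rewrite -b0 braidK add0o.
Defined.

Definition compS (A B C : permCat) (G : ssmFunctor B C) (F : ssmFunctor A B) :
  ssmFunctor A C.
Proof.
refine (@SsmFunctor A C (compF G F) _ _ _ _) => /=.
- by move=> x y; rewrite !fadd.
- by rewrite !fzero.
- by move=> f g; rewrite !faddm.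
- by move=> x y; rewrite !fbraid.
Defined.

(* Colimits in PermCat_s are given by their one-dimensional universal          *)
(* properties; the two-dimensional parts follow from these: monoidal transformations into D are the same as strict symmetric      *)
(* monoidal functors into the permutative category of arrows of D.             *)

Record freePerm (C : cat) := FreePerm {
  fr_cat :> permCat;
  fr_unit : functor C fr_cat;
  fr_lift : forall (A : permCat), functor C A -> ssmFunctor fr_cat A;
  fr_liftE : forall (A : permCat) (F : functor C A),
    eqF (compF (fr_lift F) fr_unit) F;
  fr_uniq : forall (A : permCat) (H H' : ssmFunctor fr_cat A),
    eqF (compF H fr_unit) (compF H' fr_unit) -> eqF H H'
}.

Record pushout (A B C : permCat) (f : ssmFunctor A B) (g : ssmFunctor A C) :=
Pushout {
  po_cat :> permCat;
  po_inl : ssmFunctor B po_cat;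
  po_inr : ssmFunctor C po_cat;
  po_comm : eqF (compS po_inl f) (compS po_inr g);
  po_lift : forall (D : permCat) (h : ssmFunctor B D) (k : ssmFunctor C D),
    eqF (compS h f) (compS k g) -> ssmFunctor po_cat D;
  po_liftl : forall (D : permCat) (h : ssmFunctor B D) (k : ssmFunctor C D)
    (e : eqF (compS h f) (compS k g)), eqF (compS (po_lift e) po_inl) h;
  po_liftr : forall (D : permCat) (h : ssmFunctor B D) (k : ssmFunctor C D)
    (e : eqF (compS h f) (compS k g)), eqF (compS (po_lift e) po_inr) k;
  po_uniq : forall (D : permCat) (H H' : ssmFunctor po_cat D),
    eqF (compS H po_inl) (compS H' po_inl) ->
    eqF (compS H po_inr) (compS H' po_inr) -> eqF H H'
}.

Record coproduct (I : Type) (P : I -> permCat) := Coproduct {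
  cp_cat :> permCat;
  cp_in : forall i, ssmFunctor (P i) cp_cat;
  cp_lift : forall (D : permCat),
    (forall i, ssmFunctor (P i) D) -> ssmFunctor cp_cat D;
  cp_liftE : forall (D : permCat) (F : forall i, ssmFunctor (P i) D) i,
    eqF (compS (cp_lift F) (cp_in i)) (F i);
  cp_uniq : forall (D : permCat) (H H' : ssmFunctor cp_cat D),
    (forall i, eqF (compS H (cp_in i)) (compS H' (cp_in i))) -> eqF H H'
}.

Definition fr_map (Sf : forall C : cat, freePerm C) (C D : cat)
    (F : functor C D) : ssmFunctor (Sf C) (Sf D) :=
  fr_lift (Sf C) (compF (fr_unit (Sf D)) F).

Inductive two : Set := Pa | Pb.

(* [arrowsCat I] has objects a, b and one non-identity morphism a -> b for     *)
(* each element of I.                                                          *)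
Definition arrowsCat (I : Type) : cat.
Proof.
refine (@Cat two (two + I)%type
  (fun f => match f with inl o => o | inr _ => Pa end)
  (fun f => match f with inl o => o | inr _ => Pb end)
  inl
  (fun g f => match g with inl _ => f | inr _ => g end) _ _ _ _ _ _ _) => //.
- by move=> [o|i] [o'|i'].
- by move=> [o|i] [o'|i'].
- by case.
- by move=> [o|i] [o'|i'] [o''|i''].
Defined.

Definition discCat : cat := arrowsCat Empty_set.  (* {a, b}      *)
Definition parCat : cat := arrowsCat bool.        (* {a => b}, two arrows *)
Definition arrCat : cat := arrowsCat unit.        (* {a -> b}    *)

(* {a ≅ b}: exactly one morphism (s, t) from s to t, for all s and t. *)
Definition isoCat : cat.
Proof.
refine (@Cat two (two * two)%type fst snd (fun o => (o, o))
  (fun g f => (f.1, g.2)) _ _ _ _ _ _ _) => //.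
- by case.
- by case.
Defined.

Definition pfun : functor discCat isoCat.
Proof.
refine (@Functor discCat isoCat id
  (fun f => match f with inl o => (o, o) | inr e => match e with end end)
  _ _ _ _).
- by case.
- by case.
- by [].
- by move=> [o|[]] [o'|[]] //= ->.
Defined.

Definition qfun : functor parCat arrCat.
Proof.
refine (@Functor parCat arrCat id
  (fun f => match f with inl o => inl o | inr _ => inr tt end) _ _ _ _).
- by case.
- by case.
- by [].
- by move=> [o|i] [o'|i'].
Defined.

Section Pick.

Variable A : cat.

Definition pick_ob (u v : ob A) : functor discCat A.
Proof.
refine (@Functor discCat A (fun o => match o with Pa => u | Pb => v end)
  (fun f => match f with
            | inl Pa => idm u | inl Pb => idm v
            | inr e => match e with end
            end) _ _ _ _).
- by move=> [[]|[]]; rewrite src_idm.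
- by move=> [[]|[]]; rewrite tgt_idm.
- by case.
- move=> [[]|[]] [[]|[]] //= _; set w := (X in idm X).
  + by rewrite -{3}[w]src_idm comp_idr.
  + by rewrite -{3}[w]src_idm comp_idr.
Defined.

Definition pick_arrows (I : Type) (u v : ob A) (F : I -> mor A)
    (hF : forall i, is_hom (F i) u v) : functor (arrowsCat I) A.
Proof.
refine (@Functor (arrowsCat I) A (fun o => match o with Pa => u | Pb => v end)
  (fun f => match f with inl Pa => idm u | inl Pb => idm v | inr i => F i end)
  _ _ _ _).
- by move=> [[]|i] /=; rewrite ?src_idm // (hF i).1.
- by move=> [[]|i] /=; rewrite ?tgt_idm // (hF i).2.
- by case.
- have idK w : idm w ∘ idm w = idm w :> mor A.
    by rewrite -{2}[w]src_idm comp_idr.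
  move=> [[]|i] [[]|i'] //= _; rewrite ?idK //.
  + by rewrite -(hF i').2 comp_idl.
  + by rewrite -(hF i).1 comp_idr.
Defined.

Definition pick_par (f g : mor A) (h : parallel f g) : functor parCat A.
Proof.
refine (@pick_arrows bool (src f) (tgt f) (fun i => if i then f else g) _).
by case=> //; case: h => -> ->.
Defined.

Definition inverse_pair (u v : ob A) (f f' : mor A) : Prop :=
  [/\ is_hom f u v, is_hom f' v u, f' ∘ f = idm u & f ∘ f' = idm v].

Definition pick_iso (u v : ob A) (f f' : mor A) (h : inverse_pair u v f f') :
  functor isoCat A.
Proof.
refine (@Functor isoCat A (fun o => match o with Pa => u | Pb => v end)
  (fun st => match st with
    | (Pa, Pa) => idm u | (Pa, Pb) => f | (Pb, Pa) => f' | (Pb, Pb) => idm v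
    end) _ _ _ _); case: h => [[sf tf] [sf' tf'] ff' f'f].
- by move=> [[] []] /=; rewrite ?src_idm.
- by move=> [[] []] /=; rewrite ?tgt_idm.
- by case.
- have idK w : idm w ∘ idm w = idm w :> mor A.
    by rewrite -{2}[w]src_idm comp_idr.
  move=> [[] []] [[] []] //= _; rewrite ?idK ?ff' ?f'f //.
  + by rewrite -tf' comp_idl.
  + by rewrite -sf comp_idr.
  + by rewrite -sf' comp_idr.
  + by rewrite -tf comp_idl.
Defined.

End Pick.

Section Adjoin.

Variable Sf : forall C : cat, freePerm C.

Definition adjoin_iso (B : permCat) (u v : ob B) : Type :=
  pushout (fr_map Sf pfun) (fr_lift (Sf discCat) (pick_ob u v)).

Definition adjoin_eq (B : permCat) (f g : mor B) (h : parallel f g) : Type :=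
  pushout (fr_map Sf qfun) (fr_lift (Sf parCat) (pick_par h)).

Definition new_iso (B : permCat) (u v : ob B) (Q : adjoin_iso u v) :
  mor Q := fmor (po_inl Q) (fmor (fr_unit (Sf isoCat)) (Pa, Pb)).

Definition new_inv (B : permCat) (u v : ob B) (Q : adjoin_iso u v) :
  mor Q := fmor (po_inl Q) (fmor (fr_unit (Sf isoCat)) (Pb, Pa)).

Lemma new_isoP (B : permCat) (u v : ob B) (Q : adjoin_iso u v) :
  inverse_pair (fob (po_inr Q) u) (fob (po_inr Q) v) (new_iso Q) (new_inv Q).
Proof.
have H (o : two) : fob (po_inl Q) (fob (fr_unit (Sf isoCat)) o) =
    fob (po_inr Q) (match o with Pa => u | Pb => v end).
  have [/(_ (fob (fr_unit (Sf discCat)) o)) /= e _] := po_comm Q.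
  have [/(_ o) /= e1 _] := fr_liftE (Sf discCat) (pick_ob u v).
  have [/(_ o) /= e2 _] :=
    fr_liftE (Sf discCat) (compF (fr_unit (Sf isoCat)) pfun).
  by rewrite -e1 -e -e2.
rewrite /new_iso /new_inv; split.
- by split; rewrite ?fsrc ?ftgt /= H.
- by split; rewrite ?fsrc ?ftgt /= H.
- rewrite -fcomp; last by rewrite fsrc ftgt.
  by rewrite -fcomp //= -[(Pa, Pa)]/(@idm isoCat Pa) !fidm H.
- rewrite -fcomp; last by rewrite fsrc ftgt.
  by rewrite -fcomp //= -[(Pb, Pb)]/(@idm isoCat Pb) !fidm H.
Qed.

Lemma adjoin_eqE (B : permCat) (f g : mor B) (h : parallel f g)
  (Q : adjoin_eq h) : fmor (po_inr Q) f = fmor (po_inr Q) g.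
Proof.
have [_ e] := po_comm Q.
have [_ e1] := fr_liftE (Sf parCat) (pick_par h).
have [_ e2] := fr_liftE (Sf parCat) (compF (fr_unit (Sf arrCat)) qfun).
have /= et := e (fmor (fr_unit (Sf parCat)) (inr true)).
have /= ef := e (fmor (fr_unit (Sf parCat)) (inr false)).
have /= e1t := e1 (inr true); have /= e1f := e1 (inr false).
have /= e2t := e2 (inr true); have /= e2f := e2 (inr false).
rewrite e1t in et; rewrite e1f in ef.
by rewrite -et -ef e2t e2f.
Qed.

Lemma adjoin_iso_lift_subproof (B : permCat) (u v : ob B) (A : permCat)
    (H : ssmFunctor B A) (f f' : mor A)
    (h : inverse_pair (fob H u) (fob H v) f f') :
  eqF (compS (fr_lift (Sf isoCat) (pick_iso h)) (fr_map Sf pfun))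
      (compS H (fr_lift (Sf discCat) (pick_ob u v))).
Proof.
apply: fr_uniq; split.
- move=> o /=.
  have [/(_ o) /= -> _] :=
    fr_liftE (Sf discCat) (compF (fr_unit (Sf isoCat)) pfun).
  have [/(_ o) /= -> _] := fr_liftE (Sf discCat) (pick_ob u v).
  have [/(_ o) /= -> _] := fr_liftE (Sf isoCat) (pick_iso h).
  by case: o.
- case=> [o|[]] /=.
  have [_ /(_ (inl o)) /= ->] :=
    fr_liftE (Sf discCat) (compF (fr_unit (Sf isoCat)) pfun).
  have [_ /(_ (inl o)) /= ->] := fr_liftE (Sf discCat) (pick_ob u v).
  have [_ /(_ (o, o)) /= ->] := fr_liftE (Sf isoCat) (pick_iso h).
  by case: o; rewrite fidm.
Qed.

Definition adjoin_iso_lift (B : permCat) (u v : ob B) (Q : adjoin_iso u v)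
    (A : permCat) (H : ssmFunctor B A) (f f' : mor A)
    (h : inverse_pair (fob H u) (fob H v) f f') : ssmFunctor Q A :=
  po_lift Q (adjoin_iso_lift_subproof h).

Lemma adjoin_iso_lift_base (B : permCat) (u v : ob B) (Q : adjoin_iso u v)
    (A : permCat) (H : ssmFunctor B A) (f f' : mor A)
    (h : inverse_pair (fob H u) (fob H v) f f') :
  eqF (compS (adjoin_iso_lift Q h) (po_inr Q)) H.
Proof. exact: po_liftr. Qed.

Lemma adjoin_iso_lift_new (B : permCat) (u v : ob B) (Q : adjoin_iso u v)
    (A : permCat) (H : ssmFunctor B A) (f f' : mor A)
    (h : inverse_pair (fob H u) (fob H v) f f') :
  fmor (adjoin_iso_lift Q h) (new_iso Q) = f.
Proof.
have [_ e] := po_liftl Q (adjoin_iso_lift_subproof h).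
have /= -> := e (fmor (fr_unit (Sf isoCat)) (Pa, Pb)).
by have [_ /(_ (Pa, Pb)) /= ->] := fr_liftE (Sf isoCat) (pick_iso h).
Qed.

Lemma inverse_uniq (C : cat) (u v : ob C) (f g g' : mor C) :
  inverse_pair u v f g -> inverse_pair u v f g' -> g = g'.
Proof.
move=> [[sf tf] [sg tg] gf fg] [[_ _] [sg' tg'] gf' fg'].
by rewrite -[g]comp_idr sg -fg' compA ?sf ?tf // gf -tg' comp_idl.
Qed.

Lemma adjoin_iso_uniq (B : permCat) (u v : ob B) (Q : adjoin_iso u v)
    (A : permCat) (H H' : ssmFunctor Q A) :
  eqF (compS H (po_inr Q)) (compS H' (po_inr Q)) ->
  fmor H (new_iso Q) = fmor H' (new_iso Q) -> eqF H H'.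
Proof.
move=> e en; apply: po_uniq => //; apply: fr_uniq.
have img (K : ssmFunctor Q A) : inverse_pair
    (fob K (fob (po_inr Q) u)) (fob K (fob (po_inr Q) v))
    (fmor K (new_iso Q)) (fmor K (new_inv Q)).
  have [[s1 t1] [s2 t2] c1 c2] := new_isoP Q.
  split.
  - by split; [rewrite fsrc s1 | rewrite ftgt t1].
  - by split; [rewrite fsrc s2 | rewrite ftgt t2].
  - by rewrite -fcomp ?c1 ?fidm // s2 t1.
  - by rewrite -fcomp ?c2 ?fidm // s1 t2.
have [/= eo em] := e.
have ei : fmor H (new_inv Q) = fmor H' (new_inv Q).
  have h := img H; rewrite en !eo in h.
  exact: inverse_uniq h (img H').
have o (K : ssmFunctor Q A) t : fob K (fob (po_inl Q) (fob (fr_unit (Sf isoCat)) t)) =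
    src (fmor K (match t with Pa => new_iso Q | Pb => new_inv Q end)).
  by case: t; rewrite /new_iso /new_inv !fsrc.
have oo t : fob H (fob (po_inl Q) (fob (fr_unit (Sf isoCat)) t)) =
    fob H' (fob (po_inl Q) (fob (fr_unit (Sf isoCat)) t)).
  by rewrite !o; case: t; rewrite ?en ?ei.
split=> [t|[[] []]] /=; rewrite ?oo //.
- by rewrite -[(Pa, Pa)]/(@idm isoCat Pa) !fidm oo.
- by rewrite -[(Pb, Pb)]/(@idm isoCat Pb) !fidm oo.
Qed.

Lemma adjoin_eq_lift_subproof (B : permCat) (f g : mor B) (h : parallel f g)
    (A : permCat) (H : ssmFunctor B A) (e : fmor H f = fmor H g)
    (hh : forall i : unit, is_hom (fmor H f) (fob H (src f)) (fob H (tgt f))) :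
  eqF (compS (fr_lift (Sf arrCat) (pick_arrows hh)) (fr_map Sf qfun))
      (compS H (fr_lift (Sf parCat) (pick_par h))).
Proof.
apply: fr_uniq; split.
- move=> o /=.
  have [/(_ o) /= -> _] :=
    fr_liftE (Sf parCat) (compF (fr_unit (Sf arrCat)) qfun).
  have [/(_ o) /= -> _] := fr_liftE (Sf parCat) (pick_par h).
  have [/(_ o) /= -> _] := fr_liftE (Sf arrCat) (pick_arrows hh).
  by case: o.
- move=> k /=.
  have [_ /(_ k) /= ->] :=
    fr_liftE (Sf parCat) (compF (fr_unit (Sf arrCat)) qfun).
  have [_ /(_ k) /= ->] := fr_liftE (Sf parCat) (pick_par h).
  case: k => [o|i].
    have [_ /(_ (inl o)) /= ->] := fr_liftE (Sf arrCat) (pick_arrows hh).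
    by case: o; rewrite fidm.
  have [_ /(_ (inr tt)) /= ->] := fr_liftE (Sf arrCat) (pick_arrows hh).
  by case: i.
Qed.

Lemma fmor_hom (A B : cat) (H : functor A B) (f : mor A) :
  is_hom (fmor H f) (fob H (src f)) (fob H (tgt f)).
Proof. by split; rewrite ?fsrc ?ftgt. Qed.

Definition adjoin_eq_lift (B : permCat) (f g : mor B) (h : parallel f g)
    (Q : adjoin_eq h) (A : permCat) (H : ssmFunctor B A)
    (e : fmor H f = fmor H g) : ssmFunctor Q A :=
  po_lift Q (@adjoin_eq_lift_subproof B f g h A H e (fun=> fmor_hom H f)).

Lemma adjoin_eq_lift_base (B : permCat) (f g : mor B) (h : parallel f g)
    (Q : adjoin_eq h) (A : permCat) (H : ssmFunctor B A)
    (e : fmor H f = fmor H g) :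
  eqF (compS (adjoin_eq_lift Q e) (po_inr Q)) H.
Proof. exact: po_liftr. Qed.

Lemma adjoin_eq_uniq (B : permCat) (f g : mor B) (h : parallel f g)
    (Q : adjoin_eq h) (A : permCat) (H H' : ssmFunctor Q A) :
  eqF (compS H (po_inr Q)) (compS H' (po_inr Q)) -> eqF H H'.
Proof.
move=> e; apply: po_uniq => //; apply: fr_uniq.
have [co cm] := po_comm Q.
have [_ e2] := fr_liftE (Sf parCat) (compF (fr_unit (Sf arrCat)) qfun).
have [e1 _] := fr_liftE (Sf parCat) (compF (fr_unit (Sf arrCat)) qfun).
have [/= eo em] := e.
split=> [o|[o|[]]] /=.
- by have /= <- := e1 o; move: (co (fob (fr_unit (Sf parCat)) o)) => /= ->.
- have /= <- := e2 (inl o).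
  by move: (cm (fmor (fr_unit (Sf parCat)) (inl o))) => /= ->.
- have /= <- := e2 (inr true).
  by move: (cm (fmor (fr_unit (Sf parCat)) (inr true))) => /= ->.
Qed.

End Adjoin.

(* The four stages of the construction of P{x}, for a choice Sf of free        *)
(* permutative categories.  The discrete category on {a, b} also serves as     *)
(* the category {x, y}, with x = a and y = b.                                  *)

Section Stages.

Variable Sf : forall C : cat, freePerm C.

Definition x0 : ob (Sf discCat) := fob (fr_unit (Sf discCat)) Pa.
Definition y0 : ob (Sf discCat) := fob (fr_unit (Sf discCat)) Pb.

Definition stage1 : Type := adjoin_iso Sf (x0 ⊕ y0) zero.

Definition x1 (S1 : stage1) : ob S1 := fob (po_inr S1) x0.
Definition y1 (S1 : stage1) : ob S1 := fob (po_inr S1) y0.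
Definition eps1 (S1 : stage1) : mor S1 := new_iso S1.

Definition stage2 (S1 : stage1) : Type := adjoin_iso Sf zero (y1 S1 ⊕ x1 S1).

Section Stage2.
Variables (S1 : stage1) (S2 : stage2 S1).

Definition x2 : ob S2 := fob (po_inr S2) (x1 S1).
Definition y2 : ob S2 := fob (po_inr S2) (y1 S1).
Definition eps2 : mor S2 := fmor (po_inr S2) (eps1 S1).
Definition eta2 : mor S2 := new_iso S2.

Lemma eps2_hom : is_hom eps2 (x2 ⊕ y2) zero.
Proof.
rewrite /eps2 /eps1; have [[s t] _ _ _] := new_isoP S1.
by split; [rewrite fsrc s !fadd | rewrite ftgt t !fzero].
Qed.

Lemma eta2_hom : is_hom eta2 zero (y2 ⊕ x2).
Proof.
rewrite /eta2; have [[s t] _ _ _] := new_isoP S2.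
by split; [rewrite s !fzero | rewrite t !fadd].
Qed.

Lemma triangle_x_par :
  parallel ((eps2 ⊞ idm x2) ∘ (idm x2 ⊞ eta2)) (idm x2).
Proof.
have [se te] := eps2_hom; have [sn tn] := eta2_hom.
have c : src (eps2 ⊞ idm x2) = tgt (idm x2 ⊞ eta2).
  by rewrite src_addm tgt_addm se tn src_idm tgt_idm addoA.
split.
  by rewrite src_comp // src_addm sn !src_idm addo0.
by rewrite tgt_comp // tgt_addm te !tgt_idm add0o.
Qed.

Lemma triangle_y_par :
  parallel ((idm y2 ⊞ eps2) ∘ (eta2 ⊞ idm y2)) (idm y2).
Proof.
have [se te] := eps2_hom; have [sn tn] := eta2_hom.
have c : src (idm y2 ⊞ eps2) = tgt (eta2 ⊞ idm y2).
  by rewrite src_addm tgt_addm se tn src_idm tgt_idm addoA.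
split.
  by rewrite src_comp // src_addm sn !src_idm add0o.
by rewrite tgt_comp // tgt_addm te !tgt_idm addo0.
Qed.

Definition stage3 : Type := adjoin_eq Sf triangle_x_par.

Section Stage3.
Variable S3 : stage3.

Definition x3 : ob S3 := fob (po_inr S3) x2.
Definition y3 : ob S3 := fob (po_inr S3) y2.
Definition eps3 : mor S3 := fmor (po_inr S3) eps2.
Definition eta3 : mor S3 := fmor (po_inr S3) eta2.

Lemma triangle_y_par3 :
  parallel ((idm y3 ⊞ eps3) ∘ (eta3 ⊞ idm y3)) (idm y3).
Proof.
have [se te] := eps2_hom; have [sn tn] := eta2_hom.
have [hs ht] := triangle_y_par.
have -> : (idm y3 ⊞ eps3) ∘ (eta3 ⊞ idm y3) =
    fmor (po_inr S3) ((idm y2 ⊞ eps2) ∘ (eta2 ⊞ idm y2)).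
  rewrite fcomp ?faddm ?fidm //.
  by rewrite src_addm tgt_addm se tn src_idm tgt_idm addoA.
by split; rewrite ?fsrc ?ftgt ?hs ?ht ?src_idm ?tgt_idm.
Qed.

Definition stage4 : Type := adjoin_eq Sf triangle_y_par3.

End Stage3.
End Stage2.
End Stages.

(* All the data of one construction of P{x}; the permutative category P{x}     *)
(* itself is [gen_cat].                                                        *)
Record freeInv := FreeInv {
  free_perm : forall C : cat, freePerm C;
  stg1 : stage1 free_perm;
  stg2 : stage2 stg1;
  stg3 : stage3 stg2;
  gen_cat :> stage4 stg3
}.

Definition Pcat (P : freeInv) : permCat := gen_cat P.

Section Generators.

Variable P : freeInv.

Definition gx : ob (Pcat P) := fob (po_inr (gen_cat P)) (x3 (stg3 P)).
Definition gy : ob (Pcat P) := fob (po_inr (gen_cat P)) (y3 (stg3 P)).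
Definition geps : mor (Pcat P) := fmor (po_inr (gen_cat P)) (eps3 (stg3 P)).
Definition geta : mor (Pcat P) := fmor (po_inr (gen_cat P)) (eta3 (stg3 P)).

End Generators.

(* Invertible pairs; an isomorphism is recorded together with its inverse.     *)
Record invPair (A : permCat) := InvPair {
  ip_x : ob A;
  ip_y : ob A;
  ip_eta : mor A;
  ip_eta' : mor A;
  ip_eps : mor A;
  ip_eps' : mor A;
  ip_etaP : inverse_pair zero (ip_y ⊕ ip_x) ip_eta ip_eta';
  ip_epsP : inverse_pair (ip_x ⊕ ip_y) zero ip_eps ip_eps';
  ip_triangle_x : (ip_eps ⊞ idm ip_x) ∘ (idm ip_x ⊞ ip_eta) = idm ip_x;
  ip_triangle_y : (idm ip_y ⊞ ip_eps) ∘ (ip_eta ⊞ idm ip_y) = idm ip_y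
}.

(* Strict symmetric monoidal functors out of P{x} correspond to invertible     *)
(* pairs.                                                                      *)

Section FromPair.

Variables (P : freeInv) (A : permCat) (q : invPair A).

Let Sf := free_perm P.

Definition from_pair0 : ssmFunctor (Sf discCat) A :=
  fr_lift (Sf discCat) (pick_ob (ip_x q) (ip_y q)).

Lemma from_pair0E :
  fob from_pair0 (x0 Sf) = ip_x q /\ fob from_pair0 (y0 Sf) = ip_y q.
Proof.
have [e _] := fr_liftE (Sf discCat) (pick_ob (ip_x q) (ip_y q)).
by split; [exact: (e Pa) | exact: (e Pb)].
Qed.

Lemma from_pair1_subproof : inverse_pair
  (fob from_pair0 (x0 Sf ⊕ y0 Sf)) (fob from_pair0 zero) (ip_eps q) (ip_eps' q).
Proof.
by have [ex ey] := from_pair0E; rewrite fadd fzero ex ey; apply: ip_epsP.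
Qed.

Definition from_pair1 : ssmFunctor (stg1 P) A :=
  adjoin_iso_lift (stg1 P) from_pair1_subproof.

Lemma from_pair1E :
  [/\ fob from_pair1 (x1 (stg1 P)) = ip_x q,
      fob from_pair1 (y1 (stg1 P)) = ip_y q &
      fmor from_pair1 (eps1 (stg1 P)) = ip_eps q].
Proof.
have [ex ey] := from_pair0E.
have [e _] := adjoin_iso_lift_base (stg1 P) from_pair1_subproof.
split; first by rewrite -ex; exact: e.
  by rewrite -ey; exact: e.
exact: adjoin_iso_lift_new.
Qed.

Lemma from_pair2_subproof : inverse_pair
  (fob from_pair1 zero) (fob from_pair1 (y1 (stg1 P) ⊕ x1 (stg1 P)))
  (ip_eta q) (ip_eta' q).
Proof.
by have [ex ey _] := from_pair1E; rewrite fadd fzero ex ey; apply: ip_etaP.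
Qed.

Definition from_pair2 : ssmFunctor (stg2 P) A :=
  adjoin_iso_lift (stg2 P) from_pair2_subproof.

Lemma from_pair2E :
  [/\ fob from_pair2 (x2 (stg2 P)) = ip_x q,
      fob from_pair2 (y2 (stg2 P)) = ip_y q,
      fmor from_pair2 (eps2 (stg2 P)) = ip_eps q &
      fmor from_pair2 (eta2 (stg2 P)) = ip_eta q].
Proof.
have [ex ey ee] := from_pair1E.
have [e em] := adjoin_iso_lift_base (stg2 P) from_pair2_subproof.
split; first by rewrite -ex; exact: e.
- by rewrite -ey; exact: e.
- by rewrite -ee; exact: em.
- exact: adjoin_iso_lift_new.
Qed.

Lemma from_pair3_subproof :
  fmor from_pair2 ((eps2 (stg2 P) ⊞ idm (x2 (stg2 P))) ∘
                   (idm (x2 (stg2 P)) ⊞ eta2 (stg2 P))) =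
  fmor from_pair2 (idm (x2 (stg2 P))).
Proof.
have [ex ey ee en] := from_pair2E.
have [se te] := eps2_hom (stg2 P); have [sn tn] := eta2_hom (stg2 P).
rewrite fcomp; last by rewrite src_addm tgt_addm se tn src_idm tgt_idm addoA.
by rewrite !faddm !fidm ex ee en ip_triangle_x.
Qed.

Definition from_pair3 : ssmFunctor (stg3 P) A :=
  adjoin_eq_lift (stg3 P) from_pair3_subproof.

Lemma from_pair3E :
  [/\ fob from_pair3 (x3 (stg3 P)) = ip_x q,
      fob from_pair3 (y3 (stg3 P)) = ip_y q,
      fmor from_pair3 (eps3 (stg3 P)) = ip_eps q &
      fmor from_pair3 (eta3 (stg3 P)) = ip_eta q].
Proof.
have [ex ey ee en] := from_pair2E.
have [e em] := adjoin_eq_lift_base (stg3 P) from_pair3_subproof.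
split; first by rewrite -ex; exact: e.
- by rewrite -ey; exact: e.
- by rewrite -ee; exact: em.
- by rewrite -en; exact: em.
Qed.

Lemma from_pair_subproof :
  fmor from_pair3 ((idm (y3 (stg3 P)) ⊞ eps3 (stg3 P)) ∘
                   (eta3 (stg3 P) ⊞ idm (y3 (stg3 P)))) =
  fmor from_pair3 (idm (y3 (stg3 P))).
Proof.
have [ex ey ee en] := from_pair3E.
have [se te] := eps2_hom (stg2 P); have [sn tn] := eta2_hom (stg2 P).
rewrite fcomp.
  by rewrite !faddm !fidm ey ee en ip_triangle_y.
rewrite src_addm tgt_addm src_idm tgt_idm /eps3 /eta3.
by rewrite fsrc ftgt se tn /y3 -!fadd addoA.
Qed.

Definition from_pair : ssmFunctor (Pcat P) A :=
  adjoin_eq_lift (gen_cat P) from_pair_subproof.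

Lemma from_pairE :
  [/\ fob from_pair (gx P) = ip_x q, fob from_pair (gy P) = ip_y q,
      fmor from_pair (geta P) = ip_eta q &
      fmor from_pair (geps P) = ip_eps q].
Proof.
have [ex ey ee en] := from_pair3E.
have [e em] := adjoin_eq_lift_base (gen_cat P) from_pair_subproof.
split; first by rewrite -ex; exact: e.
- by rewrite -ey; exact: e.
- by rewrite -en; exact: em.
- by rewrite -ee; exact: em.
Qed.

End FromPair.

Lemma from_pair_uniq (P : freeInv) (A : permCat)
    (H H' : ssmFunctor (Pcat P) A) :
  fob H (gx P) = fob H' (gx P) -> fob H (gy P) = fob H' (gy P) ->
  fmor H (geta P) = fmor H' (geta P) -> fmor H (geps P) = fmor H' (geps P) ->
  eqF H H'.
Proof.
move=> ex ey en ee.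
do 2!apply: adjoin_eq_uniq.
apply: adjoin_iso_uniq => //.
apply: adjoin_iso_uniq => //.
apply: fr_uniq.
split=> [[]|[[]|[]]] //=.
- by rewrite -[inl Pa]/(@idm discCat Pa) !fidm; congr idm.
- by rewrite -[inl Pb]/(@idm discCat Pb) !fidm; congr idm.
Qed.

Inductive sign : Set := Plus | Minus.

Definition mulsg (u v : sign) : sign :=
  match u, v with
  | Plus, v => v
  | Minus, Plus => Minus
  | Minus, Minus => Plus
  end.

(* (-1)^n *)
Definition signz (n : int) : sign := if odd `|n|%N then Minus else Plus.

Lemma mulsgA u v w : mulsg u (mulsg v w) = mulsg (mulsg u v) w.
Proof. by case: u v w => [] [] []. Qed.

Lemma mulsgC u v : mulsg u v = mulsg v u.
Proof. by case: u v => [] []. Qed.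

Lemma odd_abszB (m n : nat) : odd `|(m%:Z - n%:Z)%R|%N = odd m (+) odd n.
Proof.
wlog le_nm : m n / n <= m => [hw|].
  have [/hw //|/ltnW/hw e] := leqP n m.
  by rewrite -opprB abszN e addbC.
by rewrite subzn // absz_nat oddB.
Qed.

Lemma odd_abszD (m n : int) : odd `|(m + n)%R|%N = odd `|m|%N (+) odd `|n|%N.
Proof.
case: m n => m [] n; rewrite ?NegzE ?abszN.
- by rewrite -PoszD !absz_nat oddD.
- by rewrite odd_abszB !absz_nat.
- by rewrite addrC odd_abszB !absz_nat addbC.
- by rewrite -opprD abszN -PoszD !absz_nat oddD.
Qed.

Lemma signzD m n : signz (m + n)%R = mulsg (signz m) (signz n).
Proof. by rewrite /signz odd_abszD; do 2!case: odd. Qed.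

(* The morphism (k, u) is the automorphism u_k of the object k. *)
Definition superCat : cat.
Proof.
refine (@Cat int (int * sign)%type fst fst (fun k => (k, Plus))
  (fun g f => (f.1, mulsg g.2 f.2)) _ _ _ _ _ _ _) => //=.
- by case.
- by case=> k [].
- by move=> h g f _ _; rewrite mulsgA.
Defined.

Definition superZ : permCat.
Proof.
refine (@PermCat superCat (fun k j => k + j)%R 0%R
  (fun f g => ((f.1 + g.1)%R, mulsg f.2 g.2))
  (fun k j => ((k + j)%R, signz (j * k)%R)) _ _ _ _ _ _ _ _ _ _ _ _ _ _ _)
  => //=.
- by move=> [? u] [? v] [? u'] [? v'] /= _ _; case: u v u' v' => [] [] [] [].
- by move=> *; rewrite addrA.
- by move=> *; rewrite add0r.
- by move=> *; rewrite addr0.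
- by move=> *; rewrite addrA mulsgA.
- by move=> [k u]; rewrite add0r.
- by move=> [k []]; rewrite addr0.
- by move=> *; rewrite addrC.
- move=> [k u] [j v] /=; congr pair.
  by rewrite (mulsgC v u) mulsgC.
- move=> k j; congr pair.
  by rewrite [(k * j)%R]mulrC; case: signz.
- move=> k j l; congr pair; first by rewrite addrA.
  rewrite mulrDl signzD /=.
  by case: signz; case: signz.
Defined.

Definition super_pair : invPair superZ.
Proof.
by refine (@InvPair superZ 1%R (-1)%R
  (idm (zero : ob superZ)) (idm (zero : ob superZ))
  (idm (zero : ob superZ)) (idm (zero : ob superZ)) _ _ _ _).
Defined.

Definition K (P : freeInv) : ssmFunctor (Pcat P) superZ :=
  from_pair P super_pair.

Lemma K_spec (P : freeInv) :
  [/\ fob (K P) (gx P) = 1%R, fob (K P) (gy P) = (-1)%R,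
      fmor (K P) (geta P) = idm (zero : ob superZ) &
      fmor (K P) (geps P) = idm (zero : ob superZ)].
Proof. exact: from_pairE. Qed.

Definition L (f : mor superZ) : 'Z_2 :=
  match f.2 with Plus => 0%R | Minus => 1%R end.

Definition parity (P : freeInv) (f : mor (Pcat P)) : 'Z_2 := L (fmor (K P) f).

Section PG.

Variables (P : freeInv) (G : finType) (PG : coproduct (fun _ : G => Pcat P)).

Definition proj (a : G) : ssmFunctor PG (Pcat P) :=
  cp_lift PG (fun g => if g == a then idS (Pcat P) else constS (Pcat P) (Pcat P)).

Definition parity_at (a : G) (f : mor PG) : 'Z_2 := parity (fmor (proj a) f).

End PG.

(* Main.v *)
Require Import Defs.
From mathcomp Require Import all_boot all_order all_algebra.
From Stdlib Require Import ProofIrrelevance.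

(* For each generator x with inverse y, the braiding of x with itself is
   e_x + id for a unique involution e_x of the unit 0.  Call two morphisms equal
   up to sign if they differ by a sum of such e_x.  One chooses an object N(d)
   for every degree d in Z^G and isomorphisms N(d) + x -> N(d + x) whose squares
   commute up to sign.  They extend to isomorphisms N(d) + w -> N(d + deg w) for
   all words w in the generators and their inverses, and the morphisms between
   words that are compatible with these isomorphisms up to sign contain the
   generators and are closed under all operations.  By the universal property
   every morphism is of this kind, so parallel morphisms are equal up to sign.
   The a-parity of e_x is 1 for x = a and 0 otherwise, hence the parities
   determine the remaining sum of e_x. *)

Set Implicit Arguments.
Unset Strict Implicit.
Unset Printing Implicit Defensive.

Import GRing.Theory.
Local Open Scope perm_scope.

(** * Calculus in permutative categories *)

Definition st_simp := (src_addm, tgt_addm, src_idm, tgt_idm, src_braid, tgt_braid).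

Ltac st_hyps := repeat match goal with
  | H : src ?f = _ |- context [src ?f] => rewrite H
  | H : tgt ?f = _ |- context [tgt ?f] => rewrite H
  end.

(* [st] proves equations between sources and targets. *)
Ltac st_norm := repeat first
  [ progress rewrite ?st_simp
  | progress st_hyps
  | rewrite src_comp; [ | solve [st] ]
  | rewrite tgt_comp; [ | solve [st] ] ]
with st := st_norm; rewrite ?addoA ?addo0 ?add0o ?addoA; done.

Section Basics.

Variable A : permCat.
Implicit Types (v w x y z : ob A) (f g h u : mor A).

Lemma hom_id x : is_hom (idm x) x x.
Proof. by split; st. Qed.

Lemma comp_id x y f : is_hom f x y -> idm y ∘ f = f.
Proof. by case=> _ <-; rewrite comp_idl. Qed.

Lemma id_comp x y f : is_hom f x y -> f ∘ idm x = f.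
Proof. by case=> <- _; rewrite comp_idr. Qed.

Lemma id_id x : idm x ∘ idm x = idm x.
Proof. exact: comp_id (hom_id x). Qed.

Lemma hom_comp x y z f g : is_hom f x y -> is_hom g y z -> is_hom (g ∘ f) x z.
Proof. by move=> [sf tf] [sg tg]; split; st. Qed.

Lemma hom_add x y x' y' f g :
  is_hom f x y -> is_hom g x' y' -> is_hom (f ⊞ g) (x ⊕ x') (y ⊕ y').
Proof. by move=> [sf tf] [sg tg]; split; st. Qed.

Lemma hom_braid x y : is_hom (braid x y) (x ⊕ y) (y ⊕ x).
Proof. by split; st. Qed.

(** The hexagon for [x], 0, 0 makes [braid x zero] idempotent, and an invertible idempotent is an
    identity. *)
Lemma braidx0 x : braid x zero = idm x.
Proof.
have [sb tb] : is_hom (braid x zero) x x by split; st.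
have bb : braid x zero ∘ braid x zero = braid x zero.
  by have := braid_addo x zero zero; rewrite add0o add0m addm0 => <-.
have b'b : braid zero x ∘ braid x zero = idm x by rewrite braidK addo0.
have e : idm x ∘ braid x zero = braid x zero by rewrite -{1}tb comp_idl.
rewrite -[LHS]e -[in LHS]b'b -Defs.compA; [| st | st].
by rewrite bb b'b.
Qed.

(** Naturality of the braiding in [f] and [u], where both braidings with 0 are identities. Hence
    endomorphisms of the unit can be moved freely through sums. *)
Lemma unit_addC u f : is_hom u zero zero -> u ⊞ f = f ⊞ u.
Proof.
move=> [su tu]; have := braid_nat f u; rewrite su tu !braidx0.
rewrite (@comp_id (src f) (tgt f)); last by split; st.
by rewrite (@id_comp (src f) (tgt f)); last by split; st.
Qed.

Lemma unit_add_comp u f x y : is_hom u zero zero -> is_hom f x y ->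
  u ⊞ f = (u ⊞ idm y) ∘ f.
Proof.
move=> hu hf; rewrite -[f in RHS]add0m -addm_comp.
- by rewrite (id_comp hu) (comp_id hf).
- by case: hu => ? ?; st.
- by case: hf => ? ?; st.
Qed.

(** The Eckmann-Hilton argument on endomorphisms of the unit. *)
Lemma unit_add_unit u f : is_hom u zero zero -> is_hom f zero zero ->
  u ⊞ f = u ∘ f.
Proof. by move=> hu hf; rewrite (unit_add_comp hu hf) addm0. Qed.

Lemma addmE x y z w f g : is_hom f x y -> is_hom g z w ->
  f ⊞ g = (f ⊞ idm w) ∘ (idm x ⊞ g).
Proof.
move=> hf hg; rewrite -addm_comp; [|by case: hf => *; st|by case: hg => *; st].
by rewrite (id_comp hf) (comp_id hg).
Qed.

Lemma addmE' x y z w f g : is_hom f x y -> is_hom g z w ->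
  f ⊞ g = (idm y ⊞ g) ∘ (f ⊞ idm z).
Proof.
move=> hf hg; rewrite -addm_comp; [|by case: hf => *; st|by case: hg => *; st].
by rewrite (comp_id hf) (id_comp hg).
Qed.

Lemma add_idl x f g : src g = tgt f ->
  idm x ⊞ (g ∘ f) = (idm x ⊞ g) ∘ (idm x ⊞ f).
Proof. by move=> e; rewrite -addm_comp ?id_id //; st. Qed.

Lemma add_idr x f g : src g = tgt f ->
  (g ∘ f) ⊞ idm x = (g ⊞ idm x) ∘ (f ⊞ idm x).
Proof. by move=> e; rewrite -addm_comp ?id_id //; st. Qed.

Lemma inverse_pair_sym x y f f' : inverse_pair x y f f' -> inverse_pair y x f' f.
Proof. by case. Qed.

Lemma inverse_pair_id x : inverse_pair x x (idm x) (idm x).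
Proof. by split; rewrite ?id_id //; apply: hom_id. Qed.

Lemma inverse_pair_comp x y z f f' g g' :
  inverse_pair x y f f' -> inverse_pair y z g g' ->
  inverse_pair x z (g ∘ f) (f' ∘ g').
Proof.
move=> [hf hf' f'f ff'] [hg hg' g'g gg'].
split; [exact: hom_comp hf hg | exact: hom_comp hg' hf' | |];
  move: (hf) (hf') (hg) (hg') => [? ?] [? ?] [? ?] [? ?].
- rewrite Defs.compA; [|st|st]; rewrite -(Defs.compA (h := f')); [|st|st].
  by rewrite g'g (id_comp hf') f'f.
- rewrite Defs.compA; [|st|st]; rewrite -(Defs.compA (h := g)); [|st|st].
  by rewrite ff' (id_comp hg) gg'.
Qed.

Lemma inverse_pair_add x y z w f f' g g' :
  inverse_pair x y f f' -> inverse_pair z w g g' ->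
  inverse_pair (x ⊕ z) (y ⊕ w) (f ⊞ g) (f' ⊞ g').
Proof.
move=> [hf hf' f'f ff'] [hg hg' g'g gg'].
split; [exact: hom_add | exact: hom_add | |];
  move: (hf) (hf') (hg) (hg') => [? ?] [? ?] [? ?] [? ?];
  rewrite -addm_comp ?addm_idm; try st.
- by rewrite f'f g'g addm_idm.
- by rewrite ff' gg' addm_idm.
Qed.

Lemma inverse_pair_braid x y :
  inverse_pair (x ⊕ y) (y ⊕ x) (braid x y) (braid y x).
Proof. by split; rewrite ?braidK //; apply: hom_braid. Qed.

Lemma comp_inj x y z f f' g g' : inverse_pair x y f f' ->
  is_hom g y z -> is_hom g' y z -> g ∘ f = g' ∘ f -> g = g'.
Proof.
move=> [[? ?] [? ?] _ ff'] hg hg' e.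
rewrite -(id_comp hg) -(id_comp hg') -ff'.
by move: hg hg' => [? ?] [? ?]; rewrite !Defs.compA ?e; st.
Qed.

Lemma inj_comp x y z f f' g g' : inverse_pair y z f f' ->
  is_hom g x y -> is_hom g' x y -> f ∘ g = f ∘ g' -> g = g'.
Proof.
move=> [[? ?] [? ?] f'f _] hg hg' e.
rewrite -(comp_id hg) -(comp_id hg') -f'f.
by move: hg hg' => [? ?] [? ?]; rewrite -!Defs.compA ?e; st.
Qed.

(** The second hexagon: precomposed with the isomorphism [braid z (x ⊕ y)], both sides become
    identities, the right one by the first hexagon. *)
Lemma braid_addol x y z :
  braid (x ⊕ y) z = (braid x z ⊞ idm y) ∘ (idm x ⊞ braid y z).
Proof.
have h1 := inverse_pair_braid z (x ⊕ y).
have h2 : is_hom ((braid x z ⊞ idm y) ∘ (idm x ⊞ braid y z))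
  (x ⊕ y ⊕ z) (z ⊕ (x ⊕ y)) by split; st.
apply: (comp_inj h1 _ h2); first exact: hom_braid.
rewrite braidK braid_addo Defs.compA; [|st|st].
rewrite -(Defs.compA (h := braid x z ⊞ idm y)); [|st|st].
rewrite -add_idl; [|st]; rewrite braidK addm_idm !addoA.
rewrite (@id_comp (x ⊕ z ⊕ y) (z ⊕ x ⊕ y)); last by split; st.
by rewrite -add_idr; [|st]; rewrite braidK addm_idm.
Qed.

End Basics.

(** * Invertible pairs: cancelling [x], the sign of [x], and multiples of [x] *)

Section OnePair.

Variables (A : permCat) (q : invPair A).
Implicit Types (v w : ob A) (f g : mor A).

Local Notation x := (ip_x q).
Local Notation y := (ip_y q).
Local Notation eta := (ip_eta q).
Local Notation eps := (ip_eps q).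
Local Notation eps' := (ip_eps' q).

(** Both sides are sections of the isomorphism [eps ⊞ idm x], the right one by the triangle
    identity. *)
Lemma eps'x : eps' ⊞ idm x = idm x ⊞ eta.
Proof.
have h := inverse_pair_add (ip_epsP q) (inverse_pair_id x).
case: (ip_etaP q) => [[? ?] _ _ _]; case: (ip_epsP q) => [[? ?] [? ?] _ e].
apply: (inj_comp h (x := x)); [by split; st | by split; st |].
by rewrite ip_triangle_x -add_idr ?e ?addm_idm ?add0o //; st.
Qed.

(** The inverse of the map [f ↦ f ⊞ idm x] on hom sets: a pair [x ⊕ y] is created, [f] uses [x], and
    the pair is cancelled again. *)
Definition unwhisker v w f :=
  (idm w ⊞ eps) ∘ (f ⊞ idm y) ∘ (idm v ⊞ eps').

Lemma hom_unwhisker v w f :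
  is_hom f (v ⊕ x) (w ⊕ x) -> is_hom (unwhisker v w f) v w.
Proof.
case: (ip_epsP q) => [[? ?] [? ?] _ _] [? ?].
by rewrite /unwhisker; split; st.
Qed.

(** After [eps'x] the created pair appears as [eta] to the right of [f]; it slides past [f] by
    interchange, and the triangle identity for [x] removes it. *)
Lemma unwhiskerK v w f :
  is_hom f (v ⊕ x) (w ⊕ x) -> unwhisker v w f ⊞ idm x = f.
Proof.
case: (ip_etaP q) => [heta _ _ _]; case: (ip_epsP q) => [[? ?] [? ?] _ _] hf.
move: (hf) (heta) => [? ?] [? ?].
rewrite /unwhisker add_idr; [|st]; rewrite add_idr; [|st].
rewrite -!addmA eps'x addm_idm -Defs.compA; [|st|st].
have -> : (f ⊞ idm (y ⊕ x)) ∘ (idm v ⊞ (idm x ⊞ eta)) =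
          (idm w ⊞ (idm x ⊞ eta)) ∘ f.
  rewrite !addmA !addm_idm -(addmE hf heta) (addmE' hf heta).
  by rewrite addm0.
rewrite Defs.compA; [|st|st]; rewrite -add_idl; [|st].
by rewrite ip_triangle_x addm_idm (comp_id hf).
Qed.

Lemma whisker_inj v w f g : is_hom f v w -> is_hom g v w ->
  f ⊞ idm x = g ⊞ idm x -> f = g.
Proof.
move=> hf hg e.
have h := inverse_pair_add (inverse_pair_id v) (inverse_pair_sym (ip_epsP q)).
rewrite addo0 in h.
have E k : is_hom k v w ->
    (idm w ⊞ eps) ∘ (k ⊞ idm x ⊞ idm y) ∘ (idm v ⊞ eps') = k.
  case: (ip_epsP q) => [he [? ?] _ ee'] hk; move: (hk) (he) => [? ?] [? ?].
  rewrite -addmA addm_idm -(addmE' hk he) (addmE hk he) addm0.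
  rewrite -Defs.compA; [|st|st]; rewrite -add_idl ?ee'; [|st].
  by rewrite addm_idm addo0 (id_comp hk).
by rewrite -(E f hf) -(E g hg) e.
Qed.

(** The involution e_x: both copies of [x] are stripped off the self-braiding. *)
Definition bsign : mor A := unwhisker zero zero (unwhisker x x (braid x x)).

Lemma hom_bsign : is_hom bsign zero zero.
Proof.
apply: hom_unwhisker; rewrite add0o.
exact/hom_unwhisker/hom_braid.
Qed.

Lemma bsignE : bsign ⊞ idm (x ⊕ x) = braid x x.
Proof.
have h : is_hom (unwhisker x x (braid x x)) x x.
  exact/hom_unwhisker/hom_braid.
rewrite -addm_idm addmA !unwhiskerK //; first exact: hom_braid.
by rewrite !add0o.
Qed.

(** Adding [x] is injective on morphisms, and with [x ⊕ x] added the claim says that the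
    self-braiding squares to the identity. *)
Lemma bsign2 : bsign ⊞ bsign = idm zero.
Proof.
have h := hom_bsign; have h2 := hom_add h h; rewrite addo0 in h2.
have hi : is_hom (idm zero) zero (zero : ob A) by apply: hom_id.
have hx := hom_id x.
apply: (whisker_inj h2 hi); apply: (whisker_inj (hom_add h2 hx) (hom_add hi hx)).
rewrite !addm_idm -!addmA addm_idm bsignE add0o.
by rewrite (unit_add_comp h (hom_braid _ _)) bsignE braidK.
Qed.

(** [Negz k] is the integer -(k+1), hence the [k.+1] copies of [y]. *)
Definition mulx (n : int) : ob A :=
  match n with
  | Posz k => iter k (fun o => o ⊕ x) zero
  | Negz k => iter k.+1 (fun o => o ⊕ y) zero
  end.

(** A nonnegative multiple grows by the new [x] strictly; in a negative one, the last [y] cancels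
    against [x] through [eta']. *)
Definition mulx_succ (n : int) : mor A :=
  match n with
  | Posz k => idm (mulx k.+1)
  | Negz k => idm (iter k (fun o => o ⊕ y) zero) ⊞ ip_eta' q
  end.

Definition mulx_pred (n : int) : mor A :=
  match n with
  | Posz k => idm (mulx k.+1)
  | Negz k => idm (iter k (fun o => o ⊕ y) zero) ⊞ eta
  end.

Lemma mulx_succP n :
  inverse_pair (mulx n ⊕ x) (mulx (n + 1)%R) (mulx_succ n) (mulx_pred n).
Proof.
case: n => k; first by rewrite -PoszD addn1; apply: inverse_pair_id.
have -> : mulx (Negz k + 1)%R = iter k (fun o => o ⊕ y) zero.
  case: k => [|k] //.
  have -> : (Negz k.+1 + 1 = Negz k)%R; last by [].
  by rewrite !NegzE intS opprD addrAC addNr add0r.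
rewrite /= -addoA -[X in inverse_pair _ X]addo0.
exact: inverse_pair_add (inverse_pair_id _) (inverse_pair_sym (ip_etaP q)).
Qed.

End OnePair.

(** * Equality up to sign and lattices of objects *)

Section Signs.

Variables (A : permCat) (G : finType) (q : G -> invPair A).
Implicit Types (f g h u : mor A) (a b : G) (s : seq G).

Definition sgn s : mor A := foldr (fun a u => bsign (q a) ⊞ u) (idm zero) s.

Lemma hom_sgn s : is_hom (sgn s) zero zero.
Proof.
elim: s => [|a s IH] /=; first exact: hom_id.
by rewrite -[X in is_hom _ X X]addo0; apply: hom_add IH; apply: hom_bsign.
Qed.

Lemma sgn_cat s s' : sgn (s ++ s') = sgn s ⊞ sgn s'.
Proof. by elim: s => [|a s IH] /=; rewrite ?add0m // IH addmA. Qed.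

Lemma sgn_rem a s : a \in s -> sgn s = bsign (q a) ⊞ sgn (rem a s).
Proof.
elim: s => //= b s IH; rewrite inE eq_sym.
have [-> //|_ /= /IH ->] := eqVneq b a.
by rewrite addmA (unit_addC _ (hom_bsign _)) addmA.
Qed.

(** Equal signs cancel in pairs by [bsign2], by induction on the length of [s]. *)
Lemma sgn_even s : (forall a, ~~ odd (count_mem a s)) -> sgn s = idm zero.
Proof.
have [n] := ubnP (size s); elim: n s => // n IH [|a s] //= /ltnSE le_sn ev.
(* The head [a] has even multiplicity in the whole list, so it occurs an odd number of times in the
   tail, in particular at least once. *)
have as_ : a \in s.
  move: (ev a); rewrite eqxx /= negbK -has_pred1 has_count.
  by case: count.
rewrite (sgn_rem as_) addmA bsign2 add0m; apply: IH => [|b].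
  by rewrite size_rem // (leq_ltn_trans (leq_pred _)).
have := ev b; rewrite (permP (perm_to_rem as_) (pred1 b)) /=.
by case: eqP => //=; rewrite negbK.
Qed.

Lemma sgn2 s : sgn s ⊞ sgn s = idm zero.
Proof.
by rewrite -sgn_cat; apply: sgn_even => a; rewrite count_cat addnn odd_double.
Qed.

Definition eqs f g := exists s, f = sgn s ⊞ g.

Lemma eqs_refl f : eqs f f.
Proof. by exists [::]; rewrite add0m. Qed.

Lemma eqs_sym f g : eqs f g -> eqs g f.
Proof. by case=> s ->; exists s; rewrite addmA sgn2 add0m. Qed.

Lemma eqs_trans g f h : eqs f g -> eqs g h -> eqs f h.
Proof. by case=> s -> [s' ->]; exists (s ++ s'); rewrite addmA sgn_cat. Qed.

(** Signs live on the unit, where sum and composition agree, so interchange collects the signs of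
    the two factors into one. *)
Lemma eqs_comp f g f' g' : src g = tgt f -> eqs f f' -> eqs g g' ->
  eqs (g ∘ f) (g' ∘ f').
Proof.
move=> e [s ef] [s' eg]; exists (s' ++ s).
rewrite sgn_cat (unit_add_unit (hom_sgn _) (hom_sgn _)).
have [? ?] := hom_sgn s; have [? ?] := hom_sgn s'.
have e' : src g' = tgt f'.
  by move: e; rewrite ef eg; st_norm; rewrite !add0o.
by rewrite addm_comp ?ef ?eg //; st.
Qed.

Lemma eqs_add f g f' g' : eqs f f' -> eqs g g' -> eqs (f ⊞ g) (f' ⊞ g').
Proof.
case=> s -> [s' ->]; exists (s ++ s').
rewrite sgn_cat !addmA -[_ ⊞ f' ⊞ _]addmA -(unit_addC f' (hom_sgn s')).
by rewrite !addmA.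
Qed.

Definition unitv a : {ffun G -> int} := [ffun b => Posz (b == a)].

Local Notation x a := (ip_x (q a)).

(** Absorbing [x b] and then [x a] is compared with first swapping them. A strict equation is too
    much to ask: for [a = b] the two sides differ by the self-braiding, that is, by a sign. *)
Definition commutes (N : {ffun G -> int} -> ob A)
    (i : {ffun G -> int} -> G -> mor A) d a b : Prop :=
  eqs (i (d + unitv b)%R a ∘ (i d b ⊞ idm (x a)))
      (i (d + unitv a)%R b ∘ (i d a ⊞ idm (x b)) ∘ (idm (N d) ⊞ braid (x b) (x a))).

Definition translations (L : seq G) N (i i' : {ffun G -> int} -> G -> mor A) :=
  forall d a, a \in L ->
    inverse_pair (N d ⊕ x a) (N (d + unitv a)%R) (i d a) (i' d a).

(* Degrees outside of [L] are ignored: this is what lets the construction add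
   one generator at a time. *)
Definition lattice (L : seq G) N (i i' : {ffun G -> int} -> G -> mor A) :=
 [/\ N 0%R = zero,
     translations L N i i',
     forall d a, a \notin L ->
       N (d + unitv a)%R = N d /\ forall b, i (d + unitv a)%R b = i d b
   & forall d a b, a \in L -> b \in L -> commutes N i d a b].

(** By [bsignE] the self-braiding is a sign plus an identity, and the sign is central. *)
Lemma eqs_braid_xx a f v w : is_hom f (v ⊕ (x a ⊕ x a)) w ->
  eqs f (f ∘ (idm v ⊞ braid (x a) (x a))).
Proof.
move=> hf; apply: eqs_sym; exists [:: a] => /=; rewrite addm0.
have hu := hom_bsign (q a); move: (hu) (hf) => [? ?] [? ?].
rewrite -bsignE addmA -(unit_addC (idm v) hu) -addmA addm_idm.
rewrite (unit_addC f hu).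
have -> : bsign (q a) ⊞ idm (v ⊕ (x a ⊕ x a)) =
   idm (v ⊕ (x a ⊕ x a)) ⊞ bsign (q a) by rewrite (unit_addC _ hu).
by rewrite (addmE hf hu) addm0.
Qed.

Lemma commutes_xx N i i' L d a : translations L N i i' -> a \in L ->
  commutes N i d a a.
Proof.
move=> iP aL; have [[? ?] _ _ _] := iP d a aL.
have [[? ?] _ _ _] := iP (d + unitv a)%R a aL.
by apply: eqs_braid_xx; split; st.
Qed.

Lemma commutes_sym N i i' L d a b : translations L N i i' -> a \in L -> b \in L ->
  commutes N i d a b -> commutes N i d b a.
Proof.
move=> iP aL bL; have [[? ?] _ _ _] := iP d a aL.
have [[? ?] _ _ _] := iP d b bL.
have [[? ?] _ _ _] := iP (d + unitv a)%R b bL.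
have [[? ?] _ _ _] := iP (d + unitv b)%R a aL.
rewrite /commutes => c.
have := eqs_comp _ (eqs_refl (idm (N d) ⊞ braid (x a) (x b))) c.
rewrite -(Defs.compA (g := idm (N d) ⊞ braid (x b) (x a))); [|st|st].
rewrite -add_idl; [|st]; rewrite braidK addm_idm => e; apply: eqs_sym.
have := e _; rewrite (@id_comp _ (N d ⊕ (x a ⊕ x b)) (N (d + unitv a + unitv b)%R)).
  by apply; st.
by split; st.
Qed.

(** Adding [xa] to the front factor [B], past [M], commutes strictly with adding [xb] to [M].
    Naturality of the braiding in [i] and the hexagon for [M ⊕ xb] reduce this to interchange of [j]
    and [i]. *)
Lemma lattice_step_calc (B B1 M M' xa xb : ob A) (j i : mor A) :
  is_hom j (B ⊕ xa) B1 -> is_hom i (M ⊕ xb) M' ->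
  (j ⊞ idm M') ∘ (idm B ⊞ braid M' xa) ∘ (idm B ⊞ i ⊞ idm xa) ∘
    (idm (B ⊕ M) ⊞ braid xa xb) =
  (idm B1 ⊞ i) ∘ ((j ⊞ idm M) ∘ (idm B ⊞ braid M xa) ⊞ idm xb).
Proof.
move=> hj hi; move: (hj) (hi) => [? ?] [? ?].
have e : braid M' xa ∘ (i ⊞ idm xa) ∘ (idm M ⊞ braid xa xb) =
         (idm xa ⊞ i) ∘ (braid M xa ⊞ idm xb).
  have := braid_nat i (idm xa); st_norm => ->.
  rewrite braid_addol -Defs.compA; [|st|st]; rewrite -Defs.compA; [|st|st].
  rewrite -add_idl; [|st]; rewrite braidK addm_idm.
  by rewrite (@id_comp _ _ (xa ⊕ M ⊕ xb)) //; split; st.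
have -> : (j ⊞ idm M') ∘ (idm B ⊞ braid M' xa) ∘ (idm B ⊞ i ⊞ idm xa) ∘
    (idm (B ⊕ M) ⊞ braid xa xb) =
  (j ⊞ idm M') ∘ (idm B ⊞ (braid M' xa ∘ (i ⊞ idm xa) ∘ (idm M ⊞ braid xa xb))).
  rewrite -addm_idm -!addmA add_idl; [|st]; rewrite add_idl; [|st].
  by rewrite !Defs.compA //; st.
rewrite e add_idl; [|st]; rewrite Defs.compA; [|st|st].
rewrite [idm B ⊞ (_ ⊞ _)]addmA addm_idm -(addmE hj hi) (addmE' hj hi).
rewrite -Defs.compA; [|st|st]; rewrite add_idr; [|st].
by rewrite -!addmA !addm_idm.
Qed.

Lemma lattice_nil : lattice [::] (fun=> zero) (fun _ _ => idm zero)
  (fun _ _ => idm zero).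
Proof. by []. Qed.

Lemma unitvE a b : unitv a b = Posz (b == a).
Proof. by rewrite ffunE. Qed.

(** * Enlarging a lattice by one generator *)

Section Step.

Variables (L : seq G) (N : {ffun G -> int} -> ob A).
Variables (i i' : {ffun G -> int} -> G -> mor A) (a : G).
Hypotheses (aL : a \notin L) (latL : lattice L N i i').

Let B d := mulx (q a) ((d : {ffun G -> int}) a).

(** The coordinate [d a] is recorded by [B d] alone: since [a] is not in [L], the factor [N d] does
    not change with it. *)
Definition cons_ob (d : {ffun G -> int}) := B d ⊕ N d.

(** A new [x a] arrives on the right and has to be braided past [N d] to reach the multiple of [x a]
    in front. *)
Definition cons_succ (d : {ffun G -> int}) b :=
  if b == a then
    (mulx_succ (q a) (d a) ⊞ idm (N d)) ∘ (idm (B d) ⊞ braid (N d) (x a))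
  else idm (B d) ⊞ i d b.

Definition cons_pred (d : {ffun G -> int}) b :=
  if b == a then
    (idm (B d) ⊞ braid (x a) (N d)) ∘ (mulx_pred (q a) (d a) ⊞ idm (N d))
  else idm (B d) ⊞ i' d b.

Lemma addv_same d : B (d + unitv a)%R = mulx (q a) (d a + 1)%R.
Proof. by rewrite /B ffunE unitvE eqxx. Qed.

Lemma addv_other d b : b != a -> B (d + unitv b)%R = B d.
Proof. by rewrite /B ffunE unitvE eq_sym => /negbTE->; rewrite addr0. Qed.

(** [N] and [i] ignore the coordinate [a], and [B] ignores the coordinate [b], so the square is that
    of [lattice_step_calc] and needs no sign. *)
Lemma cons_commutes d b : b \in L -> commutes cons_ob cons_succ d b a.
Proof.
case: latL => _ iP off _ bL.
have ba : b != a by apply: contraNneq aL => <-.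
have [hj _ _ _] := mulx_succP (q a) (d a); have [hi _ _ _] := iP d b bL.
have [NE iE] := off d a aL; have [NE' _] := off (d + unitv b)%R a aL.
rewrite /commutes /cons_succ eqxx (negbTE ba) addv_same addv_other // iE.
have -> : (d + unitv b)%R a = d a.
  by rewrite ffunE unitvE eq_sym (negbTE ba) addr0.
have := lattice_step_calc hj hi; rewrite /cons_ob -/(B d) => <-.
exact: eqs_refl.
Qed.

Lemma lattice_cons : lattice (a :: L) cons_ob cons_succ cons_pred.
Proof.
case: (latL) => N0 iP off sq.
have P : translations (a :: L) cons_ob cons_succ cons_pred.
  move=> d b; rewrite inE /cons_ob /cons_succ /cons_pred; have [-> _|ba /= bL] := eqVneq b a.
    rewrite addv_same (off d a aL).1 -addoA.
    have := inverse_pair_add (mulx_succP (q a) (d a)) (inverse_pair_id (N d)).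
    apply: inverse_pair_comp; rewrite -addoA.
    exact: inverse_pair_add (inverse_pair_id _) (inverse_pair_braid _ _).
  rewrite addv_other // -addoA.
  exact: inverse_pair_add (inverse_pair_id _) (iP d b bL).
split=> //.
- by rewrite /cons_ob N0 /B ffunE /= add0o.
- move=> d b; rewrite inE negb_or => /andP[ba bL].
  have e : (d + unitv b)%R a = d a.
    by rewrite ffunE unitvE eq_sym (negbTE ba) addr0.
  rewrite /cons_ob /cons_succ /B e (off d b bL).1; split=> // c.
  by rewrite (off d b bL).2.
move=> d b c; rewrite !inE.
(* Equal new generators give a self-braiding, the mixed squares are [cons_commutes] and its mirror
   image, and an old square stays valid after adding [B d] in front. *)
have [-> _|ba /= bL] := eqVneq b a; have [-> _|ca /= cL] := eqVneq c a.
- by apply: (commutes_xx _ P); rewrite inE eqxx.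
- apply: (commutes_sym P); rewrite ?inE ?eqxx ?cL ?orbT //.
  exact: cons_commutes.
- by apply: cons_commutes.
- rewrite /commutes /cons_succ (negbTE ba) (negbTE ca) !addv_other //.
  have := eqs_add (eqs_refl (idm (B d))) (sq d b c bL cL).
  have [[? ?] _ _ _] := iP d b bL; have [[? ?] _ _ _] := iP d c cL.
  have [[? ?] _ _ _] := iP (d + unitv b)%R c cL.
  have [[? ?] _ _ _] := iP (d + unitv c)%R b bL.
  rewrite !add_idl; try st.
  by rewrite !addmA !addm_idm.
Qed.

End Step.

Lemma lattice_exists L : uniq L -> exists N i i', lattice L N i i'.
Proof.
elim: L => [_|a L IH /= /andP[aL /IH [N [i [i' latL]]]]].
  by do 3!eexists; apply: lattice_nil.
by do 3!eexists; apply: lattice_cons latL.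
Qed.

End Signs.

(** * Closure of the generators *)

Section WordCategory.

Variables (A : permCat) (I : eqType) (el : I -> ob A).
Implicit Types a b c : seq I.

Definition ev a : ob A := foldr (fun l o => el l ⊕ o) zero a.

Lemma ev_cat a b : ev (a ++ b) = ev a ⊕ ev b.
Proof. by elim: a => [|l a IH] /=; rewrite ?add0o // IH addoA. Qed.

Record closed_rel (T : seq I -> seq I -> mor A -> Prop) : Prop := ClosedRel {
  cr_hom : forall a b f, T a b f -> is_hom f (ev a) (ev b);
  cr_id : forall a, T a a (idm (ev a));
  cr_comp : forall a b c f g, T a b f -> T b c g -> T a c (g ∘ f);
  cr_add : forall a b c d f g, T a b f -> T c d g ->
    T (a ++ c) (b ++ d) (f ⊞ g);
  cr_braid : forall a b, T (a ++ b) (b ++ a) (braid (ev a) (ev b))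
}.

Variables (T : seq I -> seq I -> mor A -> Prop) (crT : closed_rel T).

(** The words at the two ends are part of a morphism, since different words may evaluate to the same
    object and [T] may distinguish them. *)
Record wmor := WMor {
  wsrc : seq I;
  wtgt : seq I;
  wval : mor A;
  wvalP : T wsrc wtgt wval
}.

Lemma wmor_eq (f g : wmor) :
  wsrc f = wsrc g -> wtgt f = wtgt g -> wval f = wval g -> f = g.
Proof.
case: f g => a b f Tf [a' b' g Tg] /= ea eb ef; subst.
by congr WMor; apply: proof_irrelevance.
Qed.

(** Composition is a total operation; on a pair that is not composable the arbitrary value [g] is
    returned. *)
Definition wcomp (g f : wmor) : wmor.
Proof.
case: (wsrc g =P wtgt f) => [e|_]; last exact: g.
refine (@WMor (wsrc f) (wtgt g) (wval g ∘ wval f) _).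
by apply: (cr_comp crT (wvalP f)); rewrite -e; apply: wvalP.
Defined.

Lemma wcompE g f : wsrc g = wtgt f ->
  [/\ wsrc (wcomp g f) = wsrc f, wtgt (wcomp g f) = wtgt g &
      wval (wcomp g f) = wval g ∘ wval f].
Proof. by rewrite /wcomp; case: eqP. Qed.

Lemma wval_hom (f : wmor) : is_hom (wval f) (ev (wsrc f)) (ev (wtgt f)).
Proof. exact: cr_hom crT _ _ _ (wvalP f). Qed.

Definition wordCat : Defs.cat.
Proof.
refine (@Cat (seq I) wmor wsrc wtgt (fun a => WMor (cr_id crT a)) wcomp
  _ _ _ _ _ _ _) => //=.
- by move=> g f /wcompE[].
- by move=> g f /wcompE[].
- move=> f; have [//|e1 e2 e3] := @wcompE (WMor (cr_id crT (wtgt f))) f.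
  by apply: wmor_eq; rewrite // e3 (comp_id (wval_hom f)).
- move=> f; have [//|e1 e2 e3] := @wcompE f (WMor (cr_id crT (wsrc f))).
  by apply: wmor_eq; rewrite // e3 (id_comp (wval_hom f)).
- move=> h g f hg gf.
  have [s1 t1 v1] := wcompE gf; have [s2 t2 v2] := wcompE hg.
  have [|s3 t3 v3] := @wcompE h (wcomp g f); first by rewrite t1.
  have [|s4 t4 v4] := @wcompE (wcomp h g) f; first by rewrite s2.
  apply: wmor_eq; rewrite ?s3 ?s4 ?t3 ?t4 ?v3 ?v4 ?v1 ?v2 //.
  have [? ?] := wval_hom h; have [? ?] := wval_hom g; have [? ?] := wval_hom f.
  by rewrite Defs.compA //; st_norm; rewrite ?hg ?gf.
Defined.

Definition wadd (f g : wmor) : wmor := WMor (cr_add crT (wvalP f) (wvalP g)).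

Definition wordPerm : permCat.
Proof.
refine (@PermCat wordCat cat [::] wadd
  (fun a b => WMor (cr_braid crT a b)) _ _ _ _ _ _ _ _ _ _ _ _ _ _ _) => //=.
- by move=> a b; apply: wmor_eq; rewrite //= addm_idm ev_cat.
- move=> g f g' f' e e'.
  have [s1 t1 v1] := wcompE e; have [s2 t2 v2] := wcompE e'.
  have [|s3 t3 v3] := @wcompE (wadd g g') (wadd f f'); first by rewrite /= e e'.
  apply: wmor_eq; rewrite ?s3 ?t3 ?v3 /= ?s1 ?s2 ?t1 ?t2 ?v1 ?v2 //.
  have [? ?] := wval_hom g; have [? ?] := wval_hom f.
  have [? ?] := wval_hom g'; have [? ?] := wval_hom f'.
  by rewrite addm_comp //; st_norm; rewrite ?e ?e'.
- by move=> a b c; rewrite catA.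
- by move=> a; rewrite cats0.
- by move=> f g h; apply: wmor_eq; rewrite /= ?catA ?addmA.
- by move=> f; apply: wmor_eq; rewrite /= ?add0m.
- by move=> f; apply: wmor_eq; rewrite /= ?cats0 ?addm0.
- move=> f g; have [sf tf] := wval_hom f; have [sg tg] := wval_hom g.
  have [//|s1 t1 v1] :=
    @wcompE (WMor (cr_braid crT (wtgt f) (wtgt g))) (wadd f g).
  have [//|s2 t2 v2] :=
    @wcompE (wadd g f) (WMor (cr_braid crT (wsrc f) (wsrc g))).
  apply: wmor_eq; rewrite ?s1 ?s2 ?t1 ?t2 ?v1 ?v2 //=.
  by rewrite -sf -tf -sg -tg braid_nat.
- move=> a b; have [//|s1 t1 v1] :=
    @wcompE (WMor (cr_braid crT b a)) (WMor (cr_braid crT a b)).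
  by apply: wmor_eq; rewrite ?s1 ?t1 ?v1 //= braidK ev_cat.
- move=> a b c; set g := wadd _ _; set f := wadd _ _.
  have [|s1 t1 v1] := @wcompE g f; first by rewrite /= catA.
  apply: wmor_eq; rewrite ?s1 ?t1 ?v1 /= ?catA //.
  by rewrite ev_cat braid_addo.
Defined.

Definition wordProj : ssmFunctor wordPerm A.
Proof.
unshelve refine (@SsmFunctor wordPerm A
  (@Functor wordPerm A ev wval _ _ _ _) _ _ _ _) => //=.
- by move=> f; case: (wval_hom f).
- by move=> f; case: (wval_hom f).
- by move=> g f /wcompE[].
- exact: ev_cat.
Defined.

End WordCategory.

(** * Closure under all braidings, and generation of morphisms *)

Section Closure.

Variables (A : permCat) (G : finType) (q : G -> invPair A).

Definition letter (l : G * bool) : ob A :=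
  if l.2 then ip_x (q l.1) else ip_y (q l.1).

Local Notation ev := (ev letter).
Local Notation X g := [:: (g, true)].
Local Notation Y g := [:: (g, false)].

(** Braidings are demanded only between the generators [ip_x]; closure under inverses yields those
    that involve some [ip_y]. *)
Record inv_closed_rel (T : seq (G * bool) -> seq (G * bool) -> mor A -> Prop) :
    Prop := InvClosedRel {
  ic_hom : forall a b f, T a b f -> is_hom f (ev a) (ev b);
  ic_id : forall a, T a a (idm (ev a));
  ic_comp : forall a b c f g, T a b f -> T b c g -> T a c (g ∘ f);
  ic_add : forall a b c d f g, T a b f -> T c d g ->
    T (a ++ c) (b ++ d) (f ⊞ g);
  ic_inv : forall a b f f', T a b f -> inverse_pair (ev a) (ev b) f f' ->
    T b a f';
  ic_eta : forall g, T [::] (Y g ++ X g) (ip_eta (q g));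
  ic_eps : forall g, T (X g ++ Y g) [::] (ip_eps (q g));
  ic_braid : forall g h, T (X g ++ X h) (X h ++ X g)
    (braid (ip_x (q g)) (ip_x (q h)))
}.

Variables (T : seq (G * bool) -> seq (G * bool) -> mor A -> Prop).
Hypothesis icT : inv_closed_rel T.

Let Tcomp := ic_comp icT.
Let Tadd := ic_add icT.
Let Tid := ic_id icT.
Let Tinv := ic_inv icT.

Lemma ev_letter l : ev [:: l] = letter l.
Proof. by rewrite /= addo0. Qed.

Lemma ic_eta' g : T (Y g ++ X g) [::] (ip_eta' (q g)).
Proof.
apply: (Tinv (ic_eta icT g)); rewrite /= addo0; exact: ip_etaP.
Qed.

Lemma ic_eps' g : T [::] (X g ++ Y g) (ip_eps' (q g)).
Proof.
apply: (Tinv (ic_eps icT g)); rewrite /= addo0; exact: ip_epsP.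
Qed.

Let Tbraid a b := T (a ++ b) (b ++ a) (braid (ev a) (ev b)).

Lemma ic_braid_sym a b : Tbraid a b -> Tbraid b a.
Proof.
move=> Tab; apply: (Tinv Tab); rewrite !ev_cat; exact: inverse_pair_braid.
Qed.

(* [braid z x + y] followed by [x + braid z y] is [braid z (x + y)], which is
   trivial up to [eps] by naturality. *)
Lemma ic_braid_inv a g : Tbraid a (X g) -> Tbraid a (Y g).
Proof.
move=> Tax; have Txa := ic_braid_sym Tax.
set x := ip_x (q g); set y := ip_y (q g); set z := ev a.
have [heps heps' e'e _] := ip_epsP (q g).
have [heta heta' n'n _] := ip_etaP (q g).
have hb := hom_braid z y.
move: (heps) (heps') (heta) (heta') => [? ?] [? ?] [? ?] [? ?].
have Txzy : T (X g ++ a ++ Y g) (X g ++ Y g ++ a) (idm x ⊞ braid z y).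
  have -> : idm x ⊞ braid z y =
      ((ip_eps' (q g) ⊞ idm z) ∘ (idm z ⊞ ip_eps (q g))) ∘ (braid x z ⊞ idm y).
    have -> : (ip_eps' (q g) ⊞ idm z) ∘ (idm z ⊞ ip_eps (q g)) = braid z (x ⊕ y).
      have := braid_nat (idm z) (ip_eps (q g)); st_norm; rewrite braidx0.
      rewrite (@comp_id _ (z ⊕ (x ⊕ y)) z) => [->|]; last by split; st.
      rewrite Defs.compA; [|st|st]; rewrite -add_idr; [|st].
      by rewrite e'e addm_idm (comp_id (hom_braid _ _)).
    rewrite braid_addo -Defs.compA; [|st|st]; rewrite -add_idr; [|st].
    by rewrite braidK addm_idm (@id_comp _ _ (x ⊕ y ⊕ z)) //; split; st.
  apply: (Tcomp (b := a ++ X g ++ Y g)).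
    by have := Tadd Txa (Tid (Y g)); rewrite !ev_letter -!catA.
  apply: (Tcomp (b := a)); last exact: Tadd (ic_eps' g) (Tid a).
  by have := Tadd (Tid a) (ic_eps icT g); rewrite cats0.
rewrite /Tbraid ev_letter -/z -[letter _]/y.
(* The extra [x] is removed by adding [y] and inserting [eta] before and its inverse after. *)
have -> : braid z y = (ip_eta' (q g) ⊞ idm (y ⊕ z)) ∘
    (idm y ⊞ (idm x ⊞ braid z y)) ∘ (ip_eta (q g) ⊞ idm (z ⊕ y)).
  rewrite addmA addm_idm -Defs.compA; [|st|st].
  rewrite -(addmE' heta hb) (addmE heta hb) add0m Defs.compA; [|st|st].
  by rewrite -add_idr ?n'n ?addm_idm ?add0o ?(comp_id hb) //; st.
apply: (Tcomp (b := Y g ++ X g ++ a ++ Y g)).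
  by have := Tadd (ic_eta icT g) (Tid (a ++ Y g)); rewrite ev_cat ev_letter.
apply: (Tcomp (b := Y g ++ X g ++ Y g ++ a)).
  by have := Tadd (Tid (Y g)) Txzy; rewrite ev_letter.
by have := Tadd (ic_eta' g) (Tid (Y g ++ a)); rewrite ev_cat ev_letter.
Qed.

(** The hexagon extends braidings letter by letter in the first word. This gives all words against
    [X g], then against [Y g] by [ic_braid_inv], and by symmetry and the hexagon again all pairs of
    words. *)
Lemma ic_braid_all a b : Tbraid a b.
Proof.
have Tnil c : Tbraid c [::] by rewrite /Tbraid cats0 braidx0; apply: Tid.
have consl l c d : Tbraid [:: l] d -> Tbraid c d -> Tbraid (l :: c) d.
  move=> Tl Tc; rewrite /Tbraid /= braid_addol.
  apply: (Tcomp (b := [:: l] ++ d ++ c)).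
    by have := Tadd (Tid [:: l]) Tc; rewrite ev_letter.
  by have := Tadd Tl (Tid c); rewrite ev_letter -!catA.
have wX c g : Tbraid c (X g).
  elim: c => [|[h []] c IH]; first exact/ic_braid_sym/Tnil.
    apply: consl IH; rewrite /Tbraid !ev_letter; exact: ic_braid.
  apply: consl IH; apply/ic_braid_sym/ic_braid_inv.
  by rewrite /Tbraid !ev_letter; apply: ic_braid.
have wl c l : Tbraid [:: l] c.
  by apply: ic_braid_sym; case: l => g []; [|apply: ic_braid_inv].
by elim: a => [|l a IH]; [apply/ic_braid_sym/Tnil | apply: consl].
Qed.

Lemma inv_closed_closed : closed_rel letter T.
Proof. by case: (icT) => *; split=> //; apply: ic_braid_all. Qed.

Let D := wordPerm inv_closed_closed.

Lemma wordPerm_inverse (F F' : mor D) :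
  wsrc F' = wtgt F -> wtgt F' = wsrc F ->
  inverse_pair (ev (wsrc F)) (ev (wtgt F)) (wval F) (wval F') ->
  inverse_pair (src F) (tgt F) F F'.
Proof.
move=> e e' [_ _ v v']; split; [by [] | by split | |].
- have [s1 t1 v1] := @wcompE _ _ _ _ inv_closed_closed _ _ e.
  by apply: wmor_eq; rewrite ?s1 ?t1 ?v1.
- have [s1 t1 v1] := @wcompE _ _ _ _ inv_closed_closed _ _ (esym e').
  by apply: wmor_eq; rewrite ?s1 ?t1 ?v1.
Qed.

Definition word_pair (g : G) : invPair D.
Proof.
pose Eta : mor D := WMor (ic_eta icT g).
pose Eta' : mor D := WMor (ic_eta' g).
pose Eps : mor D := WMor (ic_eps icT g).
pose Eps' : mor D := WMor (ic_eps' g).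
refine (@InvPair D (X g) (Y g) Eta Eta' Eps Eps' _ _ _ _).
- by apply: (@wordPerm_inverse Eta Eta') => //=; rewrite addo0; apply: ip_etaP.
- by apply: (@wordPerm_inverse Eps Eps') => //=; rewrite addo0; apply: ip_epsP.
- have [//|s1 t1 v1] := @wcompE _ _ _ _ inv_closed_closed
    (Eps ⊞ idm (X g : ob D)) (idm (X g : ob D) ⊞ Eta).
  by apply: wmor_eq; rewrite ?s1 ?t1 ?v1 //= addo0 ip_triangle_x.
- have [//|s1 t1 v1] := @wcompE _ _ _ _ inv_closed_closed
    (idm (Y g : ob D) ⊞ Eps) (Eta ⊞ idm (Y g : ob D)).
  by apply: wmor_eq; rewrite ?s1 ?t1 ?v1 //= addo0 ip_triangle_y.
Defined.

End Closure.

Lemma map_inverse_pair (A B : Defs.cat) (F : functor A B) u v f f' :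
  inverse_pair u v f f' ->
  inverse_pair (fob F u) (fob F v) (fmor F f) (fmor F f').
Proof.
move=> [[sf tf] [sf' tf'] e e']; split.
- by split; rewrite ?fsrc ?ftgt ?sf ?tf.
- by split; rewrite ?fsrc ?ftgt ?sf' ?tf'.
- by rewrite -fcomp ?e ?fidm // sf'.
- by rewrite -fcomp ?e' ?fidm // sf.
Qed.

Record free_on (G : Type) (B : permCat) (q : G -> invPair B) : Prop := FreeOn {
  free_lift : forall (D : permCat) (r : G -> invPair D),
    exists F : ssmFunctor B D, forall g,
      [/\ fob F (ip_x (q g)) = ip_x (r g), fob F (ip_y (q g)) = ip_y (r g),
          fmor F (ip_eta (q g)) = ip_eta (r g) &
          fmor F (ip_eps (q g)) = ip_eps (r g)];
  free_uniq : forall (D : permCat) (H H' : ssmFunctor B D),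
    (forall g,
      [/\ fob H (ip_x (q g)) = fob H' (ip_x (q g)),
          fob H (ip_y (q g)) = fob H' (ip_y (q g)),
          fmor H (ip_eta (q g)) = fmor H' (ip_eta (q g)) &
          fmor H (ip_eps (q g)) = fmor H' (ip_eps (q g))]) -> eqF H H'
}.

(** Freeness gives a functor from [B] to the category of words with [T]-morphisms. Followed by
    evaluation it fixes the generators, hence is the identity; so every [f] is the value of a
    [T]-morphism, and [W] is the functor on objects. *)
Lemma generation (G : finType) (B : permCat) (q : G -> invPair B)
    (T : seq (G * bool) -> seq (G * bool) -> mor B -> Prop) :
  free_on q -> inv_closed_rel q T ->
  exists W : ob B -> seq (G * bool),
    (forall z, ev (letter q) (W z) = z) /\
    (forall f, T (W (src f)) (W (tgt f)) f).
Proof.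
move=> fr icT; have [F FE] := free_lift fr (word_pair icT).
have [eo em] : eqF (compS (wordProj (inv_closed_closed icT)) F) (idS B).
  apply: (free_uniq fr) => g; have [ex ey en ee] := FE g.
  by split; rewrite /= ?ex ?ey ?en ?ee //= addo0.
exists (fob F); split=> // f.
have := wvalP (fmor F f : wmor _); rewrite [wval _]em.
by rewrite -[wsrc _]/(src (fmor F f)) -[wtgt _]/(tgt (fmor F f)) fsrc ftgt.
Qed.

(** * Images of invertible pairs, and the generating pairs of the free construction *)

Section MapPair.

Variables (A B : permCat) (F : ssmFunctor A B).
Variables (x y : ob A) (eta eta' eps eps' : mor A).
Hypothesis etaP : inverse_pair zero (y ⊕ x) eta eta'.
Hypothesis epsP : inverse_pair (x ⊕ y) zero eps eps'.

Lemma map_eta :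
  inverse_pair zero (fob F y ⊕ fob F x) (fmor F eta) (fmor F eta').
Proof. by rewrite -fadd -(fzero F); apply: map_inverse_pair. Qed.

Lemma map_eps :
  inverse_pair (fob F x ⊕ fob F y) zero (fmor F eps) (fmor F eps').
Proof. by rewrite -fadd -(fzero F); apply: map_inverse_pair. Qed.

Lemma map_triangle_x :
  (fmor F eps ⊞ idm (fob F x)) ∘ (idm (fob F x) ⊞ fmor F eta) =
  fmor F ((eps ⊞ idm x) ∘ (idm x ⊞ eta)).
Proof.
case: etaP epsP => [[? ?] _ _ _] [[? ?] _ _ _].
by rewrite -!fidm -!faddm -fcomp //; st.
Qed.

Lemma map_triangle_y :
  (idm (fob F y) ⊞ fmor F eps) ∘ (fmor F eta ⊞ idm (fob F y)) =
  fmor F ((idm y ⊞ eps) ∘ (eta ⊞ idm y)).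
Proof.
case: etaP epsP => [[? ?] _ _ _] [[? ?] _ _ _].
by rewrite -!fidm -!faddm -fcomp //; st.
Qed.

End MapPair.

Definition map_pair (A B : permCat) (F : ssmFunctor A B) (q : invPair A) :
  invPair B.
Proof.
refine (@InvPair B (fob F (ip_x q)) (fob F (ip_y q)) (fmor F (ip_eta q))
  (fmor F (ip_eta' q)) (fmor F (ip_eps q)) (fmor F (ip_eps' q)) _ _ _ _).
- exact: map_eta (ip_etaP q).
- exact: map_eps (ip_epsP q).
- by rewrite (map_triangle_x F (ip_etaP q) (ip_epsP q)) ip_triangle_x fidm.
- by rewrite (map_triangle_y F (ip_etaP q) (ip_epsP q)) ip_triangle_y fidm.
Defined.

Section Stages.

Variables (Sf : forall C : Defs.cat, freePerm C).
Variables (S1 : stage1 Sf) (S2 : stage2 S1) (S3 : stage3 S2) (S4 : stage4 S3).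

Lemma new_eps1 : inverse_pair (x1 S1 ⊕ y1 S1) zero (eps1 S1) (new_inv S1).
Proof. by have := new_isoP S1; rewrite fzero fadd. Qed.

Definition eps2' : mor S2 := fmor (po_inr S2) (new_inv S1).

Lemma new_eps2 : inverse_pair (x2 S2 ⊕ y2 S2) zero (eps2 S2) eps2'.
Proof. exact: (map_eps (po_inr S2) new_eps1). Qed.

Lemma new_eta2 : inverse_pair zero (y2 S2 ⊕ x2 S2) (eta2 S2) (new_inv S2).
Proof. by have := new_isoP S2; rewrite fzero fadd. Qed.

Definition eps3' : mor S3 := fmor (po_inr S3) eps2'.
Definition eta3' : mor S3 := fmor (po_inr S3) (new_inv S2).

Lemma new_eps3 : inverse_pair (x3 S3 ⊕ y3 S3) zero (eps3 S3) eps3'.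
Proof. exact: (map_eps (po_inr S3) new_eps2). Qed.

Lemma new_eta3 : inverse_pair zero (y3 S3 ⊕ x3 S3) (eta3 S3) eta3'.
Proof. exact: (map_eta (po_inr S3) new_eta2). Qed.

Lemma new_triangle_x3 :
  (eps3 S3 ⊞ idm (x3 S3)) ∘ (idm (x3 S3) ⊞ eta3 S3) = idm (x3 S3).
Proof.
rewrite (map_triangle_x (po_inr S3) new_eta2 new_eps2).
by rewrite (adjoin_eqE S3) fidm.
Qed.

(** The first two stages supply the isomorphisms [eps] and [eta], the last two impose the triangle
    identities for [x] and [y]. *)
Definition stage4_pair : invPair S4.
Proof.
refine (@InvPair S4 (fob (po_inr S4) (x3 S3)) (fob (po_inr S4) (y3 S3))
  (fmor (po_inr S4) (eta3 S3)) (fmor (po_inr S4) eta3')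
  (fmor (po_inr S4) (eps3 S3)) (fmor (po_inr S4) eps3') _ _ _ _).
- exact: (map_eta (po_inr S4) new_eta3).
- exact: (map_eps (po_inr S4) new_eps3).
- rewrite (map_triangle_x (po_inr S4) new_eta3 new_eps3).
  by rewrite new_triangle_x3 fidm.
- rewrite (map_triangle_y (po_inr S4) new_eta3 new_eps3).
  by rewrite (adjoin_eqE S4) fidm.
Defined.

End Stages.

Definition gen_pair (P : freeInv) : invPair (Pcat P) := stage4_pair (gen_cat P).

Section Generators.

Variables (P : freeInv) (G : finType) (PG : coproduct (fun _ : G => Pcat P)).

Definition gen_pairs (g : G) : invPair PG := map_pair (cp_in PG g) (gen_pair P).

Lemma gen_pairs_free : free_on gen_pairs.
Proof.
split=> [D r | D H H' HH'].
  exists (cp_lift PG (fun g => from_pair P (r g))) => g.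
  have [eo em] := cp_liftE PG (fun g => from_pair P (r g)) g.
  have [ex ey en ee] := from_pairE P (r g).
  by split; [rewrite -ex; apply: eo | rewrite -ey; apply: eo |
             rewrite -en; apply: em | rewrite -ee; apply: em].
apply: cp_uniq => g; have [ex ey en ee] := HH' g.
exact: (from_pair_uniq (H := compS H (cp_in PG g))
  (H' := compS H' (cp_in PG g)) ex ey en ee).
Qed.

End Generators.

(** * Coherence *)

Section Normalization.

Variables (A : permCat) (G : finType) (q : G -> invPair A).
Variables (N : {ffun G -> int} -> ob A) (i i' : {ffun G -> int} -> G -> mor A).
Hypothesis latN : lattice q (enum G) N i i'.
Implicit Types (d : {ffun G -> int}) (a b w : seq (G * bool)) (l : G * bool).

Local Notation ev := (ev (letter q)).
Local Notation eqs := (eqs q).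

Lemma shiftP d g :
  inverse_pair (N d ⊕ ip_x (q g)) (N (d + unitv g)%R) (i d g) (i' d g).
Proof. by case: latN => _ iP _ _; apply: iP; rewrite mem_enum. Qed.

Definition ldeg l : {ffun G -> int} :=
  if l.2 then unitv l.1 else (- unitv l.1)%R.

Definition deg w : {ffun G -> int} :=
  foldr (fun l (d : {ffun G -> int}) => (ldeg l + d)%R) 0%R w.

Lemma deg_cat a b : deg (a ++ b) = (deg a + deg b)%R.
Proof. by elim: a => [|l a IH] /=; rewrite ?add0r // IH addrA. Qed.

(** A letter [ip_y] is absorbed by splitting an [ip_x] off [N d] with [i'] and cancelling the two
    with [ip_eps]. *)
Definition act l d : mor A :=
  if l.2 then i d l.1
  else (idm (N (d - unitv l.1)%R) ⊞ ip_eps (q l.1)) ∘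
       (i' (d - unitv l.1)%R l.1 ⊞ idm (ip_y (q l.1))).

Lemma actP l d : exists f',
  inverse_pair (N d ⊕ letter q l) (N (d + ldeg l)%R) (act l d) f'.
Proof.
case: l => g []; rewrite /act /ldeg /letter /=.
  by exists (i' d g); apply: shiftP.
eexists; apply: inverse_pair_comp.
  have := inverse_pair_sym (shiftP (d - unitv g)%R g); rewrite subrK => h.
  exact: inverse_pair_add h (inverse_pair_id _).
rewrite -addoA -[X in inverse_pair _ X]addo0.
exact: inverse_pair_add (inverse_pair_id _) (ip_epsP _).
Qed.

Fixpoint norm w d : mor A :=
  if w is l :: w' then norm w' (d + ldeg l)%R ∘ (act l d ⊞ idm (ev w'))
  else idm (N d).

Lemma normP w d : exists f',
  inverse_pair (N d ⊕ ev w) (N (d + deg w)%R) (norm w d) f'.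
Proof.
elim: w d => [|l w IH] d /=.
  by exists (idm (N d)); rewrite addo0 addr0; apply: inverse_pair_id.
have [f' Hf] := actP l d; have [g' Hg] := IH (d + ldeg l)%R.
rewrite addoA addrA; eexists; apply: inverse_pair_comp Hg.
exact: inverse_pair_add Hf (inverse_pair_id _).
Qed.

Lemma hom_act l d : is_hom (act l d) (N d ⊕ letter q l) (N (d + ldeg l)%R).
Proof. by have [f' []] := actP l d. Qed.

Lemma hom_norm w d : is_hom (norm w d) (N d ⊕ ev w) (N (d + deg w)%R).
Proof. by have [f' []] := normP w d. Qed.

Lemma norm_cat a b d :
  norm (a ++ b) d = norm b (d + deg a)%R ∘ (norm a d ⊞ idm (ev b)).
Proof.
elim: a d => [|l a IH] d /=.
  by rewrite addr0 addm_idm (id_comp (hom_norm b d)).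
have [? ?] := hom_act l d; have [? ?] := hom_norm a (d + ldeg l)%R.
have [? ?] := hom_norm b (d + (ldeg l + deg a))%R.
rewrite IH -addrA add_idr; [|st]; rewrite Defs.compA; [|st_norm; by rewrite ?addrA|st].
by rewrite ev_cat -addm_idm addmA.
Qed.

Lemma norm1 l d : norm [:: l] d = act l d.
Proof. by rewrite /= addm0; apply: comp_id (hom_act l d). Qed.

(** All starting degrees [d] are required, because in a sum the second summand is normalized from
    the degree reached by the first. *)
Definition normalized a b f :=
  [/\ is_hom f (ev a) (ev b), deg a = deg b &
      forall d, eqs (norm b d ∘ (idm (N d) ⊞ f)) (norm a d)].

Lemma normalized_comp a b c f g :
  normalized a b f -> normalized b c g -> normalized a c (g ∘ f).
Proof.
move=> [hf df ef] [hg dg eg]; split; first exact: hom_comp hf hg.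
  by rewrite df.
move=> d; apply: eqs_trans (ef d); move: hf hg => [? ?] [? ?].
have [? ?] := hom_norm b d; have [? ?] := hom_norm c d.
rewrite add_idl; [|st]; rewrite Defs.compA; [|st|st].
by apply: eqs_comp (eqs_refl _ _) (eg d); st.
Qed.

Lemma normalized_add a b a' b' f f' : normalized a b f ->
  normalized a' b' f' -> normalized (a ++ a') (b ++ b') (f ⊞ f').
Proof.
move=> [hf df ef] [hf' df' ef'].
split; [by rewrite !ev_cat; apply: hom_add | by rewrite !deg_cat df df' |].
move=> d; rewrite !norm_cat -df.
have [? ?] := hom_norm a d; have [? tb] := hom_norm b d; rewrite -df in tb.
have [? ?] := hom_norm a' (d + deg a)%R.
have [sb' tb'] := hom_norm b' (d + deg a)%R.
have [? ?] := hf; have [? ?] := hf'.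
(* By interchange [f] is treated first, at degree [d], and [f'] afterwards, at degree
   [d + deg a]. *)
have -> : norm b' (d + deg a)%R ∘ (norm b d ⊞ idm (ev b')) ∘
    (idm (N d) ⊞ (f ⊞ f')) =
  norm b' (d + deg a)%R ∘ (idm (N (d + deg a)%R) ⊞ f') ∘
    (norm b d ∘ (idm (N d) ⊞ f) ⊞ idm (ev a')).
  have h : is_hom (norm b d ∘ (idm (N d) ⊞ f)) (N d ⊕ ev a) (N (d + deg a)%R).
    by split; st.
  rewrite -!Defs.compA; try st.
  congr (_ ∘ _); rewrite -(addmE' h hf') addmA -addm_comp; [|st|st].
  by rewrite (comp_id hf').
apply: eqs_comp; last exact: ef'.
  by st.
exact: eqs_add (ef d) (eqs_refl _ _).
Qed.

Lemma normalized_inv a b f f' : normalized a b f ->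
  inverse_pair (ev a) (ev b) f f' -> normalized b a f'.
Proof.
move=> [hf df ef] [_ hf' f'f ff'].
split=> // d; apply: eqs_sym.
move: (hf) (hf') => [? ?] [? ?].
have [? ?] := hom_norm a d; have [? ?] := hom_norm b d.
have := eqs_comp _ (eqs_refl q (idm (N d) ⊞ f')) (ef d).
rewrite -Defs.compA; [|st|st]; rewrite -add_idl; [|st].
by rewrite ff' addm_idm (id_comp (hom_norm b d)); apply; st.
Qed.

(** The triangle identity for [x] turns the composite into [i e g ∘ i' e g] with [e] the degree
    below [d], which is an identity; no sign arises. *)
Lemma normalized_eta g d :
  eqs (norm [:: (g, false); (g, true)] d ∘ (idm (N d) ⊞ ip_eta (q g)))
      (norm [::] d).
Proof.
rewrite -cat1s norm_cat !norm1 /act /ldeg /deg /= !addr0 !addo0.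
set e := (d - unitv g)%R.
have [hi hi' _ ii'] := shiftP e g.
have de : (e + unitv g = d)%R by rewrite subrK.
rewrite de in hi hi' ii'; move: (hi) (hi') => [? ?] [? ?].
have [heta _ _ _] := ip_etaP (q g); have [heps _ _ _] := ip_epsP (q g).
move: (heta) (heps) => [? ?] [? ?].
set x := ip_x (q g) in hi hi' heta heps *; set y := ip_y (q g) in heta heps *.
have -> : i e g ∘ ((idm (N e) ⊞ ip_eps (q g)) ∘ (i' e g ⊞ idm y) ⊞ idm x) ∘
    (idm (N d) ⊞ ip_eta (q g)) = i e g ∘ i' e g.
  rewrite -Defs.compA; [|st|st]; congr (_ ∘ _).
  rewrite add_idr; [|st]; rewrite -Defs.compA; [|st|st].
  rewrite -!addmA addm_idm -(addmE hi' heta) (addmE' hi' heta) addm0.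
  rewrite -addm_idm addmA -addmA Defs.compA; [|st|st].
  rewrite -[idm (N e) ⊞ idm x ⊞ _]addmA -add_idl; [|st].
  by rewrite ip_triangle_x addm_idm (comp_id hi').
by rewrite ii'; apply: eqs_refl.
Qed.

Lemma normalized_eps g d :
  eqs (norm [::] d ∘ (idm (N d) ⊞ ip_eps (q g)))
      (norm [:: (g, true); (g, false)] d).
Proof.
rewrite -cat1s norm_cat !norm1 /act /ldeg /deg /= !addr0 !addo0 addrK.
have [hi hi' i'i _] := shiftP d g; move: (hi) (hi') => [? ?] [? ?].
have [[? ?] _ _ _] := ip_epsP (q g).
rewrite -Defs.compA; [|st|st]; rewrite -add_idr; [|st].
rewrite i'i addm_idm (@id_comp _ _ (N d)); last by split; st.
by rewrite (@comp_id _ (N d ⊕ (ip_x (q g) ⊕ ip_y (q g)))); [apply: eqs_refl | split; st].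
Qed.

Lemma normalized_closed : inv_closed_rel q normalized.
Proof.
split.
- by move=> a b f [].
- move=> a; split=> [|//|d]; first exact: hom_id.
  by rewrite addm_idm (id_comp (hom_norm a d)); apply: eqs_refl.
- exact: normalized_comp.
- exact: normalized_add.
- exact: normalized_inv.
- move=> g; split=> [||d].
  + by rewrite /= addo0; case: (ip_etaP (q g)).
  + by rewrite /= /ldeg /= addr0 addNr.
  exact: normalized_eta.
- move=> g; split=> [||d].
  + by rewrite /= addo0; case: (ip_epsP (q g)).
  + by rewrite /= /ldeg /= addr0 addrN.
  exact: normalized_eps.
- move=> g h; split=> [||d].
  + by rewrite /= !addo0; apply: hom_braid.
  + by rewrite /= /ldeg /= !addr0 addrC.
  rewrite !norm_cat !norm1 /act /ldeg /deg /= !addr0 !addo0.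
  (* Both words are absorbed by two translations, so this is a square of the lattice, read
     backwards. *)
  case: latN => _ _ _ sq; apply: eqs_sym.
  exact: sq (mem_enum _ _) (mem_enum _ _).
Qed.

(** At degree 0 the object [N 0] is the unit, so the condition compares [f] and [g] after
    composition with the one isomorphism [norm b 0], which can be cancelled. *)
Lemma normalized_unique a b f g : normalized a b f -> normalized a b g ->
  eqs f g.
Proof.
move=> [hf _ /(_ 0%R) ef] [hg _ /(_ 0%R) eg].
have [N0 _ _ _] := latN; move: ef eg; rewrite N0 !add0m => ef eg.
have [n' nP] := normP b 0%R; rewrite N0 add0o in nP.
have [[? ?] [? ?] n'n _] := nP; move: (hf) (hg) => [? ?] [? ?].
have := eqs_comp _ (eqs_trans ef (eqs_sym eg)) (eqs_refl q n').
rewrite !Defs.compA; try st; rewrite n'n (comp_id hf) (comp_id hg).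
by apply; st.
Qed.

End Normalization.

(** The word [W] attached to an object depends on the object only, so parallel morphisms are
    normalized between the same two words. *)
Lemma coherence_up_to_sign (P : freeInv) (G : finType)
    (PG : coproduct (fun _ : G => Pcat P)) (s t : mor PG) :
  parallel s t -> eqs (gen_pairs PG) s t.
Proof.
move=> [es et].
have [N [i [i' lat]]] := lattice_exists (gen_pairs PG) (enum_uniq G).
have [W [WE WT]] := generation (gen_pairs_free PG) (normalized_closed lat).
apply: (normalized_unique lat (WT s)).
by rewrite es et; apply: WT.
Qed.

(** * Parities of the signs, and the conclusion *)

Definition sign_of (f : mor superZ) : sign := f.2.

Lemma L_inj (f g : mor superZ) : L f = L g -> sign_of f = sign_of g.
Proof. by case: f g => [k []] [l []]. Qed.

Lemma sign_of_add (f g : mor superZ) :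
  sign_of (f ⊞ g) = mulsg (sign_of f) (sign_of g).
Proof. by []. Qed.

Section Parity.

Variables (P : freeInv) (G : finType) (PG : coproduct (fun _ : G => Pcat P)).

Definition parity_functor (a : G) : ssmFunctor PG superZ :=
  compS (K P) (proj PG a).

Lemma parity_functor_x a g :
  fob (parity_functor a) (ip_x (gen_pairs PG g)) = Posz (g == a).
Proof.
have [eo _] := cp_liftE PG
  (fun g => if g == a then idS (Pcat P) else constS (Pcat P) (Pcat P)) g.
rewrite -[LHS]/(fob (K P) (fob (proj PG a) (fob (cp_in PG g) (gx P)))).
rewrite [fob (proj PG a) _](eo (gx P)).
by case: eqP => _; [case: (K_spec P) | rewrite [LHS]fzero].
Qed.

(** The functor is applied to [bsignE]: identities have sign [Plus], and the self-braiding in the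
    super integers is -1 at the object 1 and +1 at the object 0. *)
Lemma parity_bsign a g :
  sign_of (fmor (parity_functor a) (bsign (gen_pairs PG g))) =
  if g == a then Minus else Plus.
Proof.
have := congr1 (fun f => sign_of (fmor (parity_functor a) f))
  (bsignE (gen_pairs PG g)).
rewrite faddm fbraid fidm fadd parity_functor_x sign_of_add.
by case: sign_of; case: eqP.
Qed.

Lemma parity_sgn a s :
  sign_of (fmor (parity_functor a) (sgn (gen_pairs PG) s)) =
  if odd (count_mem a s) then Minus else Plus.
Proof.
elim: s => [|g s IH]; first by rewrite fidm.
rewrite [sgn _ _]/= faddm sign_of_add parity_bsign IH /=.
by case: (g == a) => /=; case: odd.
Qed.

End Parity.

Theorem theorem1p1 (P : freeInv) (G : finType)
    (PG : coproduct (fun _ : G => Pcat P)) (z w : ob PG) (s t : mor PG)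
    (hs : is_hom s z w) (ht : is_hom t z w) :
  s = t <-> (forall a : G, parity_at a s = parity_at a t).
Proof.
split=> [-> //|par].
have [|r sE] := @coherence_up_to_sign P G PG s t.
  by case: hs ht => e1 e2 [e3 e4]; split; rewrite ?e1 ?e2 ?e3 ?e4.
(* It remains to see that each [a] has even multiplicity in [r]; this multiplicity modulo 2 is the
   difference of the two [a]-parities. *)
rewrite sE sgn_even ?add0m // => a.
have := @L_inj (fmor (parity_functor PG a) s) (fmor (parity_functor PG a) t)
  (par a).
rewrite sE faddm sign_of_add parity_sgn.
by case: odd; case: sign_of.
Qed.
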